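(* For real $\lambda>0$ let $X\sim\mathrm{Poi}(\lambda)$ and let $\theta=\{\lambda\}=\lambda-\lfloor\lambda\rfloor\in[0,1)$. Put $$a_n(\theta)=-\frac{B_{n+1}(\theta)}{n(n+1)}\qquad(n\ge1).$$ Then, as $\lambda\to\infty$ through the reals, $$\mathbb E|X-\lambda|\sim\sqrt{\frac{2\lambda}{\pi}}\;\exp\Bigl(\sum_{n\ge1}\frac{a_n(\theta)}{\lambda^n}\Bigr)$$ in the following sense. Define $d_0=1$ and $d_m(\theta)=\frac1m\sum_{k=1}^m k\,a_k(\theta)\,d_{m-k}(\theta)$ for $m\ge1$. Then for every integer $M\ge0$ there is a constant $C_M$, depending only on $M$, such that for every $\lambda_0>0$ and all real $\lambda\ge\lambda_0$ (hence uniformly in $\theta\in[0,1)$), $$\Bigl|\;\mathbb E|X-\lambda|\Big/\sqrt{\frac{2\lambda}{\pi}}-\sum_{n=0}^{M}\frac{d_n(\theta)}{\lambda^n}\Bigr|\le C_M\,\lambda^{-M-1}.$$ The first coefficients are $$d_1=-\tfrac12B_2(\theta),\qquad d_2=-\tfrac16B_3(\theta)+\tfrac18B_2(\theta)^2.$$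
   Context: $B_k(t)$ are the Bernoulli polynomials, defined by $\frac{z e^{tz}}{e^z-1}=\sum_{k\ge0}B_k(t)\frac{z^k}{k!}$. $\mathrm{Poi}(\lambda)$ has mass function $e^{-\lambda}\lambda^k/k!$, $k=0,1,2,\dots$, and mean $\lambda$. *)

(* Defs.v *)
From mathcomp Require Import all_boot all_order all_algebra.
From mathcomp Require Import all_classical all_reals all_analysis.

Set Implicit Arguments.
Unset Strict Implicit.
Unset Printing Implicit Defensive.

Import Order.TTheory GRing.Theory Num.Theory.
Import numFieldNormedType.Exports.

Local Open Scope classical_set_scope.
Local Open Scope ring_scope.

(* The generating function z e^(tz) / (e^z - 1) = \sum_k B_k(t) z^k / k!, as an
   identity of convergent real series on some punctured neighbourhood of 0
   (which may depend on t); at z = 0 the left-hand side is a removable 0/0.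
   The values (B k).[t], hence the polynomials B k, are determined by it. *)
Definition bernoulli_polynomials (R : realType) (B : nat -> {poly R}) : Prop :=
  forall t : R, \forall z \near 0^',
    [series (B k).[t] * (z ^+ k / k`!%:R)]_k @ \oo -->
      z * expR (t * z) / (expR z - 1).

Definition fracpart (R : realType) (x : R) : R := x - (Num.floor x)%:~R.

(* Meaningful for n >= 1 only; the value at n = 0 is never used. *)
Definition a_coef (R : realType) (B : nat -> {poly R}) (theta : R) (n : nat) : R :=
  - ((B n.+1).[theta] / (n%:R * n.+1%:R)).

(* exp_coefs a m = [:: d_m; ...; d_0], where d_0 = 1 and
   d_m = m^-1 \sum_(1 <= k <= m) k a_k d_(m-k); see exp_coefS. *)
Fixpoint exp_coefs (R : realType) (a : nat -> R) (m : nat) : seq R :=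
  if m is m'.+1 then
    let s := exp_coefs a m' in
    (m%:R^-1 * \sum_(1 <= k < m.+1) k%:R * a k * s`_k.-1) :: s
  else [:: 1].

Definition exp_coef (R : realType) (a : nat -> R) (m : nat) : R :=
  (exp_coefs a m)`_0.

Definition d_coef (R : realType) (B : nat -> {poly R}) (theta : R) (m : nat) : R :=
  exp_coef (a_coef B theta) m.

Lemma nth_exp_coefs (R : realType) (a : nat -> R) (m i : nat) :
  (i <= m)%N -> (exp_coefs a m)`_i = exp_coef a (m - i).
Proof. by elim: m i => [|m IHm] [|i] //= le_im; rewrite IHm. Qed.

Lemma exp_coef0 (R : realType) (a : nat -> R) : exp_coef a 0 = 1.
Proof. by []. Qed.

Lemma exp_coefS (R : realType) (a : nat -> R) (m : nat) : (0 < m)%N ->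
  exp_coef a m =
  m%:R^-1 * \sum_(1 <= k < m.+1) k%:R * a k * exp_coef a (m - k).
Proof.
case: m => // m _; rewrite {1}/exp_coef /=; congr (_ * _).
apply: eq_big_nat => -[|k] //= le_km.
by rewrite nth_exp_coefs.
Qed.

(* Main.v *)
(** The telescoping [(k - lam) p_k = lam (p_(k-1) - p_k)] turns [E|X - lam|] into
    [2 lam p_m] with [m] the integer part of [lam = m + t], so that the normalised
    mean deviation is [exp g] with
    [g = ln (2 pi) / 2 + (m + 1/2) ln lam - lam - ln m!].  With [u = 1 / lam], the
    increments of [g] and of [S = \sum_n a_n(t) u^n] under [lam |-> lam + 1] have the
    same Taylor coefficients in [u] up to order [M + 1]: this is the recurrence
    [\sum_(k < N) (-1)^k C(N, k) B_k(t) = N (1 - t)^(N-1)], read off the generating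
    function.  Summing the increments, [g - S] stays within [O(u^(M+1))] of its limit
    along [lam + N], and this limit is [0] by Wallis' product.  Finally [exp S] is
    compared with [P = \sum_n d_n u^n] through [P' = P S' + O(u^M)]. *)
Require Import Defs.
From mathcomp Require Import all_boot all_order all_algebra.
From mathcomp Require Import all_classical all_reals all_analysis.
From mathcomp Require Import measurable_realfun ring lra zify.

Set Implicit Arguments.
Unset Strict Implicit.
Unset Printing Implicit Defensive.

Import Order.TTheory GRing.Theory Num.Theory.
Import numFieldNormedType.Exports.

Local Open Scope classical_set_scope.
Local Open Scope ring_scope.

(** * The mean absolute deviation of a Poisson variable in closed form *)

Lemma poisson_pmfE (R : realType) (lam : R) (k : nat) : 0 < lam ->
  poisson_pmf lam k = lam ^+ k * k`!%:R^-1 * expR (- lam).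
Proof. by move=> lam0; rewrite /poisson_pmf lam0. Qed.

Lemma poisson_pmfS (R : realType) (lam : R) (k : nat) : 0 < lam ->
  k.+1%:R * poisson_pmf lam k.+1 = lam * poisson_pmf lam k.
Proof.
move=> lam0; rewrite !poisson_pmfE // factS natrM invfM exprS.
have k0 : k.+1%:R != 0 :> R by rewrite pnatr_eq0.
have f0 : k`!%:R != 0 :> R by rewrite pnatr_eq0 -lt0n fact_gt0.
move: k.+1%:R k`!%:R k0 f0 => a b a0 b0; by field; rewrite a0 b0.
Qed.

(** By [poisson_pmfS] the summand is [(k + 1) p_(k+1) - k p_k], a telescoping form that needs no
    convention for [p_(-1)] at [k = 0]. *)
Lemma poisson_sum_lt (R : realType) (lam : R) (n : nat) : 0 < lam ->
  \sum_(0 <= k < n) (lam - k%:R) * poisson_pmf lam k = n%:R * poisson_pmf lam n.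
Proof.
move=> lam0; elim: n => [|n IHn]; first by rewrite big_nil mul0r.
rewrite big_nat_recr //= IHn poisson_pmfS //; ring.
Qed.

(** The sign of [k - lam] changes between [m] and [m + 1]. Both halves telescope, and each
    contributes [(m + 1) p_(m+1) = lam p_m] at the cut. *)
Lemma poisson_abs_dev_sum (R : realType) (lam : R) (m n : nat) : 0 < lam ->
  m%:R <= lam -> lam < m.+1%:R -> (m < n)%N ->
  \sum_(0 <= k < n) `|k%:R - lam| * poisson_pmf lam k =
  2 * lam * poisson_pmf lam m - n%:R * poisson_pmf lam n.
Proof.
move=> lam0 mlam lamm mn.
have lt_m : \sum_(0 <= k < m.+1) `|k%:R - lam| * poisson_pmf lam k =
    \sum_(0 <= k < m.+1) (lam - k%:R) * poisson_pmf lam k.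
  apply: eq_big_nat => k /andP[_ km]; congr (_ * _).
  rewrite ler0_norm ?opprB // subr_le0; apply: le_trans mlam.
  by rewrite ler_nat -ltnS.
have gt_m : \sum_(m.+1 <= k < n) `|k%:R - lam| * poisson_pmf lam k =
    - \sum_(m.+1 <= k < n) (lam - k%:R) * poisson_pmf lam k.
  rewrite -sumrN; apply: eq_big_nat => k /andP[mk _]; rewrite -mulNr opprB.
  congr (_ * _); rewrite ger0_norm // subr_ge0; apply: le_trans (ltW lamm) _.
  by rewrite ler_nat.
rewrite (big_cat_nat _ mn) //= lt_m gt_m.
have := poisson_sum_lt n lam0; rewrite (big_cat_nat _ mn) //=.
rewrite poisson_sum_lt // poisson_pmfS // => h; lra.
Qed.

(** Since [(n + 1) p_(n+1) = lam p_n], this reduces to the general term of the convergent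
    exponential series tending to [0]. *)
Lemma cvg_natr_poisson_pmf (R : realType) (lam : R) : 0 < lam ->
  (fun n => n%:R * poisson_pmf lam n) @ \oo --> (0 : R).
Proof.
move=> lam0; apply/cvgrPdist_lt => e e0.
have /cvgrPdist_lt/(_ (e / (lam * expR (- lam)))) : exp_coeff lam @ \oo --> (0 : R).
  by apply: cvg_series_cvg_0; exact: is_cvg_series_exp_coeff.
have le0 : 0 < lam * expR (- lam) by rewrite mulr_gt0 ?expR_gt0.
move=> /(_ (divr_gt0 e0 le0)) [N _ hN]; exists N.+1 => // -[|n] // /= Nn.
have := hN n Nn; rewrite /= !sub0r !normrN poisson_pmfS // poisson_pmfE //.
rewrite ltr_pdivlMr // exp_coeffE => h.
rewrite !normrM in h *; rewrite (gtr0_norm lam0) (gtr0_norm (expR_gt0 _)).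
apply: le_lt_trans h; rewrite le_eqVlt; apply/orP; left; apply/eqP.
by ring.
Qed.

Lemma poisson_mean_abs_dev (R : realType) (lam : R) (m : nat) (d : measure_display)
    (T : measurableType d) (P : probability T R) (X : {RV P >-> nat}) :
  0 < lam -> m%:R <= lam -> lam < m.+1%:R ->
  (forall k : nat, P [set w | X w = k] = (poisson_pmf lam k)%:E) ->
  ('E_P[fun w => `|(X w)%:R - lam|%R] = (2 * lam * poisson_pmf lam m)%:E)%E.
Proof.
move=> lam0 mlam lamm PX; rewrite unlock.
pose F k := [set w | X w = k].
have mF k : measurable (F k).
  by rewrite -[F k]setTI; exact: (measurable_funP X measurableT [set k]).
have FT : \bigcup_k F k = setT by apply/seteqP; split => w // _; exists (X w).
have tF : trivIset setT F.
  by apply/trivIsetP => i j _ _ ij; apply/seteqP; split => // w [/= Xi Xj];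
    move: ij; rewrite -Xi -Xj eqxx.
(* The integral is cut along the level sets of [X], on which the integrand is constant. *)
transitivity (\int[P]_(w in \bigcup_k F k) (`|(X w)%:R - lam|)%:E)%E.
  by rewrite FT.
rewrite ge0_integral_bigcup //; last first.
  rewrite FT; apply/measurable_EFinP; apply/measurableT_comp => //.
  exact: (measurableT_comp (f := fun k : nat => k%:R - lam)).
have Ek k : (\int[P]_(w in F k) (`|(X w)%:R - lam|)%:E =
    (`|k%:R - lam| * poisson_pmf lam k)%:E)%E.
  under eq_integral => w /[!inE] /= -> do [].
  have := integral_cst P (mF k) (`|k%:R - lam|)%:E; rewrite /= PX -EFinM => <-.
  by [].
under eq_eseriesr => k _ do rewrite Ek.
apply/cvg_lim => //.
have -> : (fun n : nat => \sum_(0 <= k < n) (`|k%:R - lam| * poisson_pmf lam k)%:E)%E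
   = EFin \o (fun n => \sum_(0 <= k < n) `|k%:R - lam| * poisson_pmf lam k).
  by apply/funext => n /=; rewrite sumEFin.
apply: cvg_EFin; first by apply: nearW.
have c : (fun n => 2 * lam * poisson_pmf lam m - n%:R * poisson_pmf lam n) @ \oo
    --> 2 * lam * poisson_pmf lam m - 0.
  by apply: cvgB; [exact: cvg_cst|exact: cvg_natr_poisson_pmf].
rewrite subr0 in c; apply: cvg_trans c; apply: near_eq_cvg.
exists m.+1 => // n /= mn; rewrite (poisson_abs_dev_sum lam0 mlam lamm) //.
Qed.

(** * Wallis' product, with a rate of convergence *)

Section Wallis.
Variable R : realType.
Implicit Types (n : nat) (x : R).

(* The recursion is the reduction formula for the integral of [sin ^+ n]. *)
Fixpoint sin_pow_primitive n : R -> R :=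
  match n with
  | 0 => id
  | 1 => - cos
  | n'.+2 => n'.+2%:R^-1 *:
      (n'.+1%:R *: sin_pow_primitive n' - cos * (sin : R -> R) ^+ n'.+1)
  end.

Lemma is_derive_sin_pow_primitive n x :
  is_derive x 1 (sin_pow_primitive n) (sin x ^+ n).
Proof.
elim/ltn_ind: n x => -[|[|n]] IHn x /=.
- exact: is_derive_id.
- by apply: is_derive_eq; rewrite opprK expr1.
have IH := IHn n (leqW (leqnn n.+1)) x.
apply: is_derive_eq; rewrite ?/GRing.scale /=.
have n2 : n.+2%:R != 0 :> R by rewrite pnatr_eq0.
rewrite [(sin ^+ n.+1) x](_ : _ = sin x ^+ n.+1); last first.
  by elim: n.+1 => [|k IHk]; rewrite ?expr0 // !exprS -IHk.
apply: (mulfI n2); rewrite (mulVKf n2).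
have c2 : cos x * cos x = 1 - sin x ^+ 2 by rewrite -expr2 cos2sin2.
have -> : cos x * (n.+1%:R * sin x ^+ n * cos x) = n.+1%:R * sin x ^+ n * (1 - sin x ^+ 2).
  by rewrite -c2; ring.
by rewrite !exprS -[n.+2%:R]natr1; ring.
Qed.

(** The integral of [sin ^+ n] over [[0, pi / 2]], written with an explicit primitive so that only
    derivatives and the mean value theorem are involved. *)
Definition wallis n : R := sin_pow_primitive n (pi / 2) - sin_pow_primitive n 0.

Lemma wallisSS n : n.+2%:R * wallis n.+2 = n.+1%:R * wallis n.
Proof.
rewrite /wallis /= !fctE cos_pihalf sin0 expr0n /= !mul0r !mulr0 !subr0.
rewrite /GRing.scale /= -mulrBr mulrA mulfV ?pnatr_eq0 // mul1r; ring.
Qed.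

Lemma wallis0 : wallis 0 = pi / 2.
Proof. by rewrite /wallis /= subr0. Qed.

Lemma wallis1 : wallis 1 = 1.
Proof. by rewrite /wallis /= !fctE cos_pihalf cos0; ring. Qed.

(** Mean value theorem for the difference of the two primitives, whose derivative
    [sin ^+ n - sin ^+ n.+1] is nonnegative on [[0, pi / 2]]. *)
Lemma wallis_nonincreasing n : wallis n.+1 <= wallis n.
Proof.
have pi0 : 0 <= pi / 2 :> R by rewrite divr_ge0 // pi_ge0.
rewrite /wallis.
move: (is_derive_sin_pow_primitive n) (is_derive_sin_pow_primitive n.+1).
move: (sin_pow_primitive n) (sin_pow_primitive n.+1) => J0 J1 dJ0 dJ1.
have dJ x : is_derive x 1 (J0 - J1) (sin x ^+ n - sin x ^+ n.+1).
  by have D0 := dJ0 x; have D1 := dJ1 x; exact: is_deriveB.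
have [c] : exists2 c, c \in `[0, pi / 2]%R & (J0 - J1) (pi / 2) - (J0 - J1) 0 =
    (sin c ^+ n - sin c ^+ n.+1) * (pi / 2 - 0).
  apply: MVT_segment => // x.
  by apply: continuous_subspaceT => y; apply/differentiable_continuous/derivable1_diffP.
rewrite in_itv /= => /andP[c0 cpi]; rewrite !fctE subr0 => E.
have s0 : 0 <= sin c.
  apply: sin_ge0_pi; rewrite c0 /=; apply: le_trans cpi _.
  by rewrite ler_pdivrMr // ler_peMr ?pi_ge0 // ler1n.
have : 0 <= (sin c ^+ n - sin c ^+ n.+1) * (pi / 2).
  rewrite mulr_ge0 // subr_ge0 exprS ler_piMl ?exprn_ge0 //; exact: sin_le1.
rewrite -E => H; lra.
Qed.

Lemma wallis_gt0 n : 0 < wallis n.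
Proof.
elim/ltn_ind: n => -[|[|n]] IHn.
- by rewrite wallis0 divr_gt0 // pi_gt0.
- by rewrite wallis1.
rewrite -(@pmulr_rgt0 _ n.+2%:R) // wallisSS mulr_gt0 //.
by apply: IHn; apply: leqW.
Qed.

Lemma wallis_mulS n : n.+1%:R * (wallis n * wallis n.+1) = pi / 2.
Proof.
elim: n => [|n IHn]; first by rewrite wallis0 wallis1 mulr1 mul1r.
by rewrite -IHn mulrCA wallisSS; ring.
Qed.

(** The central binomial coefficient of order [2n], divided by [4 ^+ n]. *)
Definition central_ratio n : R := n.*2`!%:R / (4 ^+ n * n`!%:R ^+ 2).

Lemma central_ratioS n :
  n.+1.*2%:R * central_ratio n.+1 = n.*2.+1%:R * central_ratio n.
Proof.
rewrite /central_ratio doubleS !factS !natrM exprS -muln2 -!natr1 !natrM.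
have f0 : n`!%:R != 0 :> R by rewrite pnatr_eq0 -lt0n fact_gt0.
have n1 : n%:R + 1 != 0 :> R by rewrite natr1 pnatr_eq0.
move: n`!%:R n%:R f0 n1 => b c b0 c0.
by field; rewrite b0 c0 expf_neq0 // lt0r_neq0 //; lra.
Qed.

Lemma wallis_double n : wallis n.*2 = pi / 2 * central_ratio n.
Proof.
elim: n => [|n IHn].
  by rewrite wallis0 /central_ratio double0 fact0 expr0 expr1n mulr1 divr1 mulr1.
apply: (@mulfI _ n.+1.*2%:R); first by rewrite pnatr_eq0.
by rewrite mulrCA central_ratioS doubleS wallisSS IHn; ring.
Qed.

(** By monotonicity, the square of [wallis n.*2] lies between its products with the next and with
    the previous [wallis] value; [wallis_mulS] evaluates both products. *)
Lemma central_ratio_bounds n : (0 < n)%N ->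
  n.*2%:R / n.*2.+1%:R <= pi * n%:R * central_ratio n ^+ 2 <= 1.
Proof.
move=> n0; have pi0 := pi_gt0 R.
have n0' : 0 < n%:R :> R by rewrite ltr0n.
have W0 := wallis_gt0 n.*2.
have E : pi * n%:R * central_ratio n ^+ 2 = 4 * n%:R / pi * wallis n.*2 ^+ 2.
  by rewrite wallis_double; move: (pi : R) (lt0r_neq0 pi0) => p p0; field.
have W1 := wallis_mulS n.*2.
have W2 : n.*2%:R * (wallis n.*2.-1 * wallis n.*2) = pi / 2.
  by rewrite -[in LHS](prednK (_ : 0 < n.*2)%N) ?double_gt0 // wallis_mulS.
have L1 := wallis_nonincreasing n.*2.
have L2 := wallis_nonincreasing n.*2.-1.
rewrite prednK ?double_gt0 // in L2.
rewrite E; apply/andP; split.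
  have -> : n.*2%:R / n.*2.+1%:R =
      4 * n%:R / pi * (wallis n.*2 * wallis n.*2.+1).
    apply: (@mulfI _ n.*2.+1%:R); first by rewrite pnatr_eq0.
    rewrite mulrCA mulfV ?pnatr_eq0 // [RHS]mulrCA W1 -muln2 natrM.
    by clear -pi0; move: (pi : R) (lt0r_neq0 pi0) => p p0; field.
  rewrite ler_pM2l; last by rewrite divr_gt0 // mulr_gt0.
  by rewrite expr2 ler_pM2l.
rewrite [leRHS](_ : _ = 4 * n%:R / pi * (wallis n.*2.-1 * wallis n.*2)); last first.
  have -> : 4 * n%:R = 2 * n.*2%:R :> R by rewrite -muln2 natrM; ring.
  by rewrite mulrAC -[2 * _ * _]mulrA W2; move: (pi : R) (lt0r_neq0 pi0) => p p0; field.
rewrite ler_pM2l; last by rewrite divr_gt0 // mulr_gt0.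
by rewrite expr2 ler_pM2r.
Qed.

End Wallis.

(** * Expansions at [0] from the right *)

Section PowerSeriesAtZero.
Variable R : realType.
Implicit Types (f g : R -> R) (K n : nat) (x : R) (p q : {poly R}).

(** One side suffices, because small positive points already determine the coefficients of a
    polynomial; the point [0], singular for the generating function, is left out. *)
Definition bigO_right K f := exists C delta : R,
  0 < delta /\ forall x, 0 < x < delta -> `|f x| <= C * x ^+ K.

Lemma bigO_rightD K f g : bigO_right K f -> bigO_right K g ->
  bigO_right K (fun x => f x + g x).
Proof.
move=> [C1 [d1 [d10 h1]]] [C2 [d2 [d20 h2]]].
exists (C1 + C2), (Num.min d1 d2); split; first by rewrite lt_min d10.
move=> x; rewrite lt_min => /and3P[x0 x1 x2].
apply: le_trans (ler_normD _ _) _; rewrite mulrDl lerD //.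
  by apply: h1; rewrite x0.
by apply: h2; rewrite x0.
Qed.

Lemma bigO_rightM K n f g : bigO_right K f -> bigO_right n g ->
  bigO_right (K + n) (fun x => f x * g x).
Proof.
move=> [C1 [d1 [d10 h1]]] [C2 [d2 [d20 h2]]].
exists (C1 * C2), (Num.min d1 d2); split; first by rewrite lt_min d10.
move=> x; rewrite lt_min => /and3P[x0 x1 x2].
rewrite normrM exprD mulrACA; apply: ler_pM => //.
  by apply: h1; rewrite x0.
by apply: h2; rewrite x0.
Qed.

Lemma bigO_rightN K f : bigO_right K f -> bigO_right K (fun x => - f x).
Proof.
by move=> [C [d [d0 h]]]; exists C, d; split => // x hx; rewrite normrN h.
Qed.

Lemma bigO_rightW K n f : (K <= n)%N -> bigO_right n f -> bigO_right K f.
Proof.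
move=> Kn [C [d [d0 h]]]; exists `|C|, (Num.min d 1); split; first by rewrite lt_min d0 ltr01.
move=> x; rewrite lt_min => /and3P[x0 xd x1].
have /h/le_trans : 0 < x < d by rewrite x0.
apply; apply: (@le_trans _ _ (`|C| * x ^+ n)).
  by rewrite ler_wpM2r ?ler_norm // exprn_ge0 // ltW.
by rewrite ler_wpM2l // ler_wiXn2l // ltW.
Qed.
Lemma eq_bigO_right K f g : (exists2 delta, 0 < delta &
    forall x, 0 < x < delta -> f x = g x) -> bigO_right K f -> bigO_right K g.
Proof.
move=> [d d0 fg] [C1 [d1 [d10 h1]]].
exists C1, (Num.min d1 d); split; first by rewrite lt_min d10.
move=> x; rewrite lt_min => /and3P[x0 x1 x2].
by rewrite -fg ?x0 // h1 // x0.
Qed.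

Lemma bigO_right_poly p : bigO_right 0 (horner p).
Proof.
exists (\sum_(i < size p) `|p`_i|), 1; split => // x /andP[x0 x1].
rewrite expr0 mulr1 horner_coef; apply: le_trans (ler_norm_sum _ _ _) _.
apply: ler_sum => i _; rewrite normrM ler_piMr // normrX (gtr0_norm x0).
by rewrite exprn_ile1 // ltW.
Qed.

(** Write [p = q 'X + p_0]. Letting [x] tend to [0] forces [p_0 = 0]; then [q] is small to one order
    less, and induction applies to it. *)
Lemma bigO_right_poly_coef K p k : bigO_right K (horner p) -> (k < K)%N -> p`_k = 0.
Proof.
elim: K p k => // K IHK p k hp.
have pE : p = (\poly_(i < size p) p`_i.+1) * 'X + (p`_0)%:P.
  apply/polyP => -[|i]; rewrite coefD coefMX coefC /= ?add0r // coef_poly addr0.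
  by case: ltnP => // /leqW /leq_sizeP ->.
set q : {poly R} := \poly_(_ < _) _ in pE.
have [Cq [dq [dq0 hq]]] := bigO_right_poly q.
have [C [d [d0 h]]] := hp.
have p0 : p`_0 = 0.
  apply/eqP; rewrite -normr_le0; apply/ler_addgt0Pl => e e0; rewrite addr0.
  pose A := `|C| + `|Cq| + 1.
  have A0 : 0 < A by rewrite ltr_wpDl // addr_ge0.
  (* Below [d] and [dq] both estimates hold, below [1] powers of [x] are at most [x], and below
     [e / A] the final bound [A * x] is at most [e]. *)
  pose x := Num.min (Num.min 1 (e / A)) (Num.min d dq) / 2.
  have M0 : 0 < Num.min (Num.min 1 (e / A)) (Num.min d dq).
    by rewrite !lt_min ltr01 divr_gt0 //= d0.
  have x0 : 0 < x by rewrite divr_gt0.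
  have : x < Num.min (Num.min 1 (e / A)) (Num.min d dq).
    by rewrite ltr_pdivrMr // ltr_pMr // ltr1n.
  rewrite !lt_min => /andP[/andP[x1 xe] /andP[xd xdq]].
  have hx : `|p.[x]| <= C * x ^+ K.+1 by apply: h; rewrite x0.
  have hqx : `|q.[x]| <= Cq by have := hq x; rewrite x0 xdq expr0 mulr1; exact.
  have px : p.[x] = q.[x] * x + p`_0 by rewrite {1}pE !hornerE.
  have -> : p`_0 = p.[x] - q.[x] * x by rewrite px addrC addKr.
  apply: le_trans (ler_normB _ _) _.
  have B1 : `|p.[x]| <= `|C| * x.
    apply: le_trans hx _; apply: (@le_trans _ _ (`|C| * x ^+ K.+1)).
      by rewrite ler_wpM2r ?ler_norm // exprn_ge0 // ltW.
    by rewrite ler_wpM2l // exprS ler_piMr ?exprn_ile1 // ltW.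
  have B2 : `|q.[x] * x| <= `|Cq| * x.
    by rewrite normrM (gtr0_norm x0) ler_pM2r // (le_trans hqx) // ler_norm.
  apply: le_trans (lerD B1 B2) _; rewrite -mulrDl.
  apply: (@le_trans _ _ (A * x)); first by rewrite ler_pM2r // /A lerDl.
  by rewrite mulrC -ler_pdivlMr // ltW.
case: k => // k kK.
have -> : p`_k.+1 = q`_k by rewrite {1}pE p0 addr0 coefMX.
apply: IHK kK; exists C, d; split => // x /andP[x0 xd].
have : `|p.[x]| <= C * x ^+ K.+1 by apply: h; rewrite x0.
by rewrite pE p0 addr0 hornerMX normrM (gtr0_norm x0) exprSr mulrA ler_pM2r.
Qed.

(** The subtracted [2 * x ^+ n] makes the induction on [n] close:
    [x ^+ n + 2 * x ^+ n.+1 <= 2 * x ^+ n]. *)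
Lemma sum_geometric_tail_le (x : R) (K n : nat) : 0 <= x -> x <= 1 / 2 -> (K <= n)%N ->
  \sum_(K <= k < n) x ^+ k <= 2 * x ^+ K - 2 * x ^+ n.
Proof.
move=> x0 x1; elim: n => [|n IHn]; first by rewrite leqn0 => /eqP ->; rewrite big_nil subrr.
rewrite leq_eqVlt => /orP[/eqP -> | Kn]; first by rewrite big_geq // subrr.
rewrite big_nat_recr //=; apply: le_trans (lerD (IHn Kn) (lexx _)) _.
have : 2 * x ^+ n.+1 <= x ^+ n.
  rewrite exprS mulrA ler_piMl ?exprn_ge0 //; lra.
by set a := x ^+ n.+1; set b := x ^+ n; lra.
Qed.

(** At a fixed point [y] of convergence the terms are bounded by some [A]; for [x < y / 2] the tail
    is then dominated by a geometric series of ratio [x / y]. *)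
Lemma power_series_bigO_right (c : R ^nat) (f : R -> R) (delta : R) K : 0 < delta ->
  (forall x, 0 < x < delta -> series (fun k => c k * x ^+ k) @ \oo --> f x) ->
  bigO_right K (fun x => f x - (\poly_(k < K) c k).[x]).
Proof.
move=> d0 hf; have [y y0 yd] : exists2 y, 0 < y & 0 < y < delta.
  by exists (delta / 2); rewrite divr_gt0 // ltr_pdivrMr // ltr_pMr // ltr1n.
have : cvgn (series (fun k => c k * y ^+ k)) by apply/cvg_ex; exists (f y); exact: hf.
move=> /cvg_series_bounded [A0 [_ hA]].
pose A := `|A0| + 1.
have A1 : 0 <= A by rewrite addr_ge0.
have {}hA k : `|c k * y ^+ k| <= A.
  by apply: hA => //; rewrite /A (le_lt_trans (ler_norm A0)) // ltrDl.
exists (2 * A / y ^+ K), (y / 2); split; first by rewrite divr_gt0.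
move=> x /andP[x0 xy].
have xd : 0 < x < delta.
  by rewrite x0 (lt_trans xy) // (lt_trans _ (andP yd).2) // ltr_pdivrMr // ltr_pMr // ltr1n.
have hS := hf x xd.
have hS' : (fun n => series (fun k => c k * x ^+ k) n - (\poly_(k < K) c k).[x]) @ \oo
   --> f x - (\poly_(k < K) c k).[x] by apply: cvgB => //; exact: cvg_cst.
have /(@cvg_norm _ _ _ _) hN := hS'.
rewrite -(cvg_lim _ hN) //.
apply: limr_le; first by apply/cvg_ex; eexists; exact: hN.
exists K => // n /= Kn.
rewrite horner_poly /series /= -(big_mkord predT (fun k => c k * x ^+ k)) (big_cat_nat _ Kn) //=.
rewrite [X in `|X|]addrC addKr.
have q0 : 0 <= x / y by rewrite divr_ge0 // ltW.
have q1 : x / y <= 1 / 2.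
  by rewrite ler_pdivrMr //; lra.
apply: le_trans (ler_norm_sum _ _ _) _.
apply: (@le_trans _ _ (A * \sum_(K <= k < n) (x / y) ^+ k)).
  rewrite mulr_sumr; apply: ler_sum => k _.
  have -> : c k * x ^+ k = c k * y ^+ k * (x / y) ^+ k.
    by rewrite exprMn exprVn [x ^+ k * _]mulrC mulrA mulfK // expf_neq0 // lt0r_neq0.
  by rewrite normrM ler_pM // ger0_norm // exprn_ge0.
apply: (@le_trans _ _ (A * (2 * (x / y) ^+ K))).
  rewrite ler_wpM2l //; apply: le_trans (sum_geometric_tail_le q0 q1 Kn) _.
  by rewrite gerBl mulr_ge0 // exprn_ge0.
by rewrite exprMn exprVn le_eqVlt; apply/orP; left; apply/eqP; ring.
Qed.

Lemma expR_bigO_right (a : R) K :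
  bigO_right K (fun x => expR (a * x) - (\poly_(k < K) (a ^+ k / k`!%:R)).[x]).
Proof.
apply: (power_series_bigO_right (delta := 1)) => // x _.
have -> : (fun k => a ^+ k / k`!%:R * x ^+ k) = exp_coeff (a * x).
  by apply/funext => k; rewrite /exp_coeff /= exprMn mulrAC.
exact: is_cvg_series_exp_coeff.
Qed.

End PowerSeriesAtZero.

(** * The recurrence for the Bernoulli polynomials *)

(** Compares the coefficients of order [N + 1] in [f(x) (e^x - 1) = x e^((1-t)x)], where [f] is the
    generating function at [- x]. Replacing each factor by a truncation changes both sides only by
    [O(x^(N+2))]. *)
Lemma bernoulli_recurrence (R : realType) (B : nat -> {poly R}) (t : R) (N : nat) :
  bernoulli_polynomials B ->
  \sum_(k < N.+1) (-1) ^+ k * 'C(N.+1, k)%:R * (B k).[t] = N.+1%:R * (1 - t) ^+ N.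
Proof.
move=> /(_ t) [/= delta delta0 hB].
pose c k := (-1) ^+ k * ((B k).[t] / k`!%:R).
(* The generating function at [- x]; multiplying it by [expR x - 1] gives the recurrence. *)
pose f (x : R) := x * expR ((1 - t) * x) / (expR x - 1).
have hc x : 0 < x < delta -> series (fun k => c k * x ^+ k) @ \oo --> f x.
  move=> /andP[x0 xd].
  have e0 : expR x - 1 != 0 by rewrite gt_eqF // subr_gt0 expR_gt1.
  have -> : f x = (- x) * expR (t * - x) / (expR (- x) - 1).
    have E : expR (- x) - 1 = - (expR x - 1) / expR x.
      by rewrite expRN; field; rewrite gt_eqF ?expR_gt0.
    have E2 : expR ((1 - t) * x) = expR x * expR (t * - x).
      by rewrite -expRD; congr expR; ring.
    by rewrite E /f E2; field; rewrite e0 gt_eqF ?expR_gt0.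
  have -> : (fun k => c k * x ^+ k) = (fun k => (B k).[t] * ((- x) ^+ k / k`!%:R)).
    by apply/funext => k; rewrite /c [(- x) ^+ k]exprNn; ring.
  apply: hB => /=; last by rewrite oppr_eq0 gt_eqF.
  by rewrite sub0r opprK gtr0_norm.
have fO := power_series_bigO_right N.+2 delta0 hc.
set p := \poly_(k < _) c k in fO.
have eO := expR_bigO_right (R := R) 1 N.+2.
set q := \poly_(k < _) _ in eO.
have sO := bigO_rightM (bigO_right_poly 'X) (expR_bigO_right (1 - t) N.+2).
set s := \poly_(k < _) _ in sO.
have key : bigO_right N.+2 (horner (p * (q - 1) - 'X * s)).
  have h1 := bigO_rightM fO (bigO_right_poly (q - 1)).
  have h2 := bigO_rightM fO eO.
  have h3 := bigO_rightM (bigO_right_poly p) eO.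
  have W m n (g : R -> R) : bigO_right (m + n) g -> bigO_right (maxn m n) g.
    by apply: bigO_rightW; rewrite geq_max leq_addr leq_addl.
  (* With [e = expR x], the last three errors add up as [(f - p)(q - 1) + (f - p)(e - q) + p (e - q)
     = f (e - 1) - p (q - 1)]. *)
  have := bigO_rightD (W _ _ _ sO) (bigO_rightN (bigO_rightD (W _ _ _ h1)
    (bigO_rightD (bigO_rightW (leq_addr _ _) h2) (W _ _ _ h3)))).
  rewrite max0n; apply: eq_bigO_right; exists delta => // x /andP[x0 _].
  have e0 : expR x - 1 != 0 by rewrite gt_eqF // subr_gt0 expR_gt1.
  have fx : x * expR ((1 - t) * x) = f x * expR x - f x by rewrite /f; field.
  have -> : (p * (q - 1) - 'X * s).[x] = p.[x] * (q.[x] - 1) - x * s.[x].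
    by rewrite !hornerE.
  have -> : (q - 1).[x] = q.[x] - 1 by rewrite !hornerE.
  by rewrite hornerX mul1r mulrBr fx; ring.
have := bigO_right_poly_coef key (ltnSn N.+1).
rewrite coefB coefXM /= coefM => /eqP; rewrite subr_eq0 => /eqP.
(* This removes the top term of the convolution, so that [B N.+1] does not occur in the
   recurrence. *)
have q0 : (q - 1)`_0 = 0 by rewrite coefB coef1 coef_poly expr1n fact0 divr1 subrr.
rewrite big_ord_recr /= subnn q0 mulr0 addr0.
rewrite /s coef_poly (leqnSn N.+1) => E.
have F0 n : n`!%:R != 0 :> R by rewrite pnatr_eq0 -lt0n fact_gt0.
apply: (@mulIf _ (N.+1`!%:R^-1)); first by rewrite invr_eq0.
transitivity ((1 - t) ^+ N / N`!%:R); last first.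
  rewrite factS natrM; have := F0 N; have : N.+1%:R != 0 :> R by rewrite pnatr_eq0.
  by move: N.+1%:R N`!%:R => a b a0 b0; field; rewrite a0 b0.
rewrite -E mulr_suml; apply: eq_bigr => k _.
have kN : (k < N.+1)%N by [].
rewrite coefB coef1 subn_eq0 leqNgt kN subr0 !coef_poly expr1n.
have -> : (N.+1 - k < N.+2)%N by rewrite ltnS leq_subr.
have -> : (k < N.+2)%N by exact: ltnW.
rewrite /c -(bin_fact (ltnW kN)) !natrM.
have := F0 k; have := F0 (N.+1 - k)%N.
have : 'C(N.+1, k)%:R != 0 :> R by rewrite pnatr_eq0 -lt0n bin_gt0 ltnW.
move: ('C(_, _)%:R) (_`!%:R) (_`!%:R) => a b b' a0 b0 b0'.
by field; rewrite a0 b0 b0'.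
Qed.

(** * Taylor bounds for the logarithm and for negative powers of [1 + u] *)

Section TaylorBounds.
Variable R : realType.
Implicit Types (u x : R) (K m n : nat).

Lemma geometric_alt_remainder K u : 1 + u != 0 ->
  (1 + u)^-1 - \sum_(j < K) (- u) ^+ j = (- u) ^+ K / (1 + u).
Proof.
move=> u1; elim: K => [|K IHK]; first by rewrite big_ord0 subr0 expr0 mul1r.
by rewrite big_ord_recr /= opprD addrA IHK exprS; field.
Qed.

Lemma is_derive_ln1Dx_taylor K x : 0 < 1 + x ->
  is_derive x 1 (fun y => ln (1 + y) - \sum_(j < K) (-1) ^+ j * y ^+ j.+1 / j.+1%:R)
    ((- x) ^+ K / (1 + x)).
Proof.
move=> x0; rewrite -(geometric_alt_remainder _ (lt0r_neq0 x0)).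
apply: is_deriveB.
  have D := is_derive1_ln x0.
  have D2 : is_derive x 1 (fun y : R => 1 + y) 1.
    by have := is_deriveD (is_derive_cst (1 : R) x 1) (is_derive_id x 1); rewrite add0r.
  have := is_derive1_comp D D2.
  by rewrite mulr1.
elim: K => [|K IHK].
  rewrite (_ : (fun _ => _) = cst 0) ?big_ord0; first exact: is_derive_cst.
  by apply/funext => y; rewrite big_ord0.
rewrite (_ : (fun _ => _) = (fun y => \sum_(j < K) (-1) ^+ j * y ^+ j.+1 / j.+1%:R) +
    ((-1) ^+ K / K.+1%:R) *: (id ^+ K.+1)); last first.
  apply/funext => y; rewrite big_ord_recr /= !fctE; congr (_ + _).
  by rewrite mulrAC; congr (_ * _); elim: K.+1 => // k IHk; rewrite !exprS IHk.
rewrite big_ord_recr /=; apply: is_deriveD.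
apply: is_derive_eq; rewrite /GRing.scale /= mulr1 [(- x) ^+ K]exprNn.
by rewrite mulrA mulfVK // pnatr_eq0.
Qed.

(** Mean value theorem for the remainder, which vanishes at [0] and whose derivative
    [(- c) ^+ K / (1 + c)] is at most [x ^+ K] in absolute value. *)
Lemma ln1Dx_taylor K x : 0 <= x ->
  `|ln (1 + x) - \sum_(j < K) (-1) ^+ j * x ^+ j.+1 / j.+1%:R| <= x ^+ K.+1.
Proof.
move=> x0; pose f (y : R) := ln (1 + y) - \sum_(j < K) (-1) ^+ j * y ^+ j.+1 / j.+1%:R.
have f0 : f 0 = 0.
  rewrite /f addr0 ln1 big1 ?subr0 // => j _.
  by rewrite exprS mul0r mulr0 mul0r.
have df (y : R) : 0 <= y -> is_derive y 1 f ((- y) ^+ K / (1 + y)).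
  by move=> y0; apply: is_derive_ln1Dx_taylor; rewrite ltr_pwDl.
have [c] : exists2 c, c \in `[0, x]%R & f x - f 0 = (- c) ^+ K / (1 + c) * (x - 0).
  apply: MVT_segment => // [y|].
    by rewrite in_itv /= => /andP[y0 _]; apply: df; exact: ltW.
  apply: derivable_within_continuous => y.
  by rewrite in_itv /= => /andP[y0 _]; have [] := df y y0.
rewrite in_itv /= f0 !subr0 => /andP[c0 cx]; rewrite -/(f x) => ->.
have c1 : 0 < 1 + c by rewrite ltr_pwDl.
rewrite normrM (ger0_norm x0) exprSr ler_wpM2r // normrM normrX normrN (ger0_norm c0).
rewrite ger0_norm ?invr_ge0 ?(ltW c1) // ler_pdivrMr //.
apply: (@le_trans _ _ (x ^+ K)); first by rewrite lerXn2r.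
by rewrite ler_peMr ?exprn_ge0 // lerDl.
Qed.

(** Multiplication by [1 + u] turns the truncated series of [(1 + u) ^- m.+2] into that of
    [(1 + u) ^- m.+1], by Pascal's rule, with a single boundary term. *)
Lemma binomial_series_mul m K u :
  (1 + u) * \sum_(i < K.+1) (-1) ^+ i * 'C(m.+1 + i, i)%:R * u ^+ i =
  \sum_(i < K.+1) (-1) ^+ i * 'C(m + i, i)%:R * u ^+ i +
  (-1) ^+ K * 'C(m.+1 + K, K)%:R * u ^+ K.+1.
Proof.
elim: K => [|K IHK].
  by rewrite !big_ord_recr !big_ord0 /= !bin0 expr0 expr1; ring.
rewrite big_ord_recr /= mulrDr IHK [in RHS]big_ord_recr /=.
rewrite -!addrA; congr (_ + _).
have -> : 'C(m.+1 + K.+1, K.+1)%:R = 'C(m + K.+1, K.+1)%:R + 'C(m.+1 + K, K)%:R :> R.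
  by rewrite -natrD addnS binS addSnnS.
by rewrite !exprS; ring.
Qed.

Lemma negpow_taylor m K : exists2 C : R, 0 <= C & forall u, 0 <= u ->
  `|(1 + u) ^- m.+1 - \sum_(i < K) (-1) ^+ i * 'C(m + i, i)%:R * u ^+ i| <= C * u ^+ K.
Proof.
have inv1 (u : R) : 0 <= u -> 0 <= (1 + u)^-1 <= 1.
  by move=> u0; rewrite invr_ge0 addr_ge0 //= invf_le1 ?lerDl // ltr_pwDl.
elim: m => [|m [C C0 IHm]].
  exists 1 => // u u0; have u1 : 0 < 1 + u by rewrite ltr_pwDl.
  rewrite expr1 (eq_bigr (fun i : 'I_K => (- u) ^+ i)); last first.
    by move=> i _; rewrite add0n binn mulr1 -exprNn.
  rewrite geometric_alt_remainder ?lt0r_neq0 // normrM normrX normrN (ger0_norm u0).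
  by have /andP[v0 v1] := inv1 u u0; rewrite (ger0_norm v0) mul1r ler_piMr ?exprn_ge0.
(* [binomial_series_mul] concerns nonempty truncations, so the empty one is treated apart. *)
case: K IHm => [|K] IHm.
  exists 1 => // u u0; rewrite big_ord0 subr0 expr0 mulr1 -exprVn.
  have /andP[v0 v1] := inv1 u u0.
  by rewrite ger0_norm ?exprn_ge0 // exprn_ile1.
exists (C + 'C(m.+1 + K, K)%:R) => [|u u0]; first by rewrite addr_ge0.
have u1 : 1 + u != 0 by rewrite lt0r_neq0 // ltr_pwDl.
have /andP[v0 v1] := inv1 u u0.
have -> : (1 + u) ^- m.+2 - \sum_(i < K.+1) (-1) ^+ i * 'C(m.+1 + i, i)%:R * u ^+ i =
    (1 + u)^-1 * ((1 + u) ^- m.+1 - \sum_(i < K.+1) (-1) ^+ i * 'C(m + i, i)%:R * u ^+ i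
     - (-1) ^+ K * 'C(m.+1 + K, K)%:R * u ^+ K.+1).
  rewrite -addrA -opprD -binomial_series_mul mulrBr mulKf //.
  by rewrite [in LHS]exprS invfM.
rewrite normrM (ger0_norm v0); apply: le_trans (ler_piMl _ v1) _ => //.
apply: le_trans (ler_normB _ _) _; rewrite mulrDl lerD ?IHm //.
by rewrite !normrM normrX normrN1 expr1n mul1r (ger0_norm (exprn_ge0 _ u0)) ger0_norm.
Qed.

End TaylorBounds.

(** * The Taylor coefficients of the two increments *)

(** The two sides are the coefficients of [u ^+ q.+1] in [S(u / (1 + u)) - S(u)] and in
    [stirling_step t u]. The denominators of [a_coef] raise ['C(q, i)] to ['C(q.+2, i.+2)], so the
    recurrence with [N = q + 1] applies once its terms in [B 0] and [B 1] are split off. *)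
Lemma bernoulli_step_coef (R : realType) (B : nat -> {poly R}) (t : R) (q : nat) :
  bernoulli_polynomials B ->
  \sum_(i < q) a_coef B t i.+1 * ((-1) ^+ (q - i) * 'C(q, i)%:R) =
  (-1) ^+ q * (- q.+2%:R^-1 + (3 / 2 - t) / q.+1%:R - (1 - t) ^+ q.+1 / q.+1%:R).
Proof.
move=> hB.
have B0 : (B 0).[t] = 1.
  have := bernoulli_recurrence t 0 hB; rewrite big_ord_recr big_ord0 /=.
  by rewrite bin0 !expr0 add0r !mul1r.
have B1 : (B 1%N).[t] = t - 1 / 2.
  have := bernoulli_recurrence t 1 hB; rewrite !big_ord_recr big_ord0 /=.
  by rewrite bin0 bin1 B0 !expr0 expr1 => h; lra.
have := bernoulli_recurrence t q.+1 hB.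
rewrite !big_ord_recl /= expr0 bin0 B0 /bump /= !add1n expr1 bin1 B1 => E.
have E2 : \sum_(i < q) (-1) ^+ i.+2 * 'C(q.+2, i.+2)%:R * (B i.+2).[t] =
    q.+2%:R * (1 - t) ^+ q.+1 - 1 + q.+2%:R * (t - 1 / 2).
  rewrite [LHS](_ : _ = \sum_(i < q) (-1) ^+ bump 0 (bump 0 i) *
    'C(q.+2, bump 0 (bump 0 i))%:R * (B (bump 0 (bump 0 i))).[t]) //.
  by move: E; set S := \sum_(_ < _) _ => E; lra.
have n1 : q.+1%:R != 0 :> R by rewrite pnatr_eq0.
have n2 : q.+2%:R != 0 :> R by rewrite pnatr_eq0.
transitivity (- (-1) ^+ q / (q.+1%:R * q.+2%:R) *
   \sum_(i < q) (-1) ^+ i.+2 * 'C(q.+2, i.+2)%:R * (B i.+2).[t]).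
  rewrite mulr_sumr; apply: eq_bigr => i _; rewrite /a_coef.
  have i1 : i.+1%:R != 0 :> R by rewrite pnatr_eq0.
  have i2 : i.+2%:R != 0 :> R by rewrite pnatr_eq0.
  have sg : (-1) ^+ q = (-1) ^+ (q - i) * (-1) ^+ i.+2 :> R.
    by rewrite -exprD !addnS subnK 1?ltnW // !exprS; ring.
  have sg2 : (-1) ^+ i.+2 * (-1) ^+ i.+2 = 1 :> R by rewrite -expr2 sqrr_sign.
  have bE : q.+1%:R * q.+2%:R * 'C(q, i)%:R = i.+1%:R * i.+2%:R * 'C(q.+2, i.+2)%:R :> R.
    have b1 := mul_bin_diag q.+2 i.+1; have b2 := mul_bin_diag q.+1 i.
    rewrite /= in b1 b2; rewrite -!natrM; congr _%:R.
    by rewrite -mulnA mulnCA b2 mulnCA b1 mulnA.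
  have -> : 'C(q, i)%:R = i.+1%:R * i.+2%:R * 'C(q.+2, i.+2)%:R / (q.+1%:R * q.+2%:R) :> R.
    by rewrite -bE mulrAC mulfV ?mul1r // mulf_neq0.
  rewrite sg; move: sg2 i1 i2 n1 n2.
  move: (B _).[t] ((-1) ^+ (q - i)) ((-1) ^+ i.+2) ('C(_, _)%:R) (i.+1%:R) (i.+2%:R)
    (q.+1%:R) (q.+2%:R) => b s1 s2 c x1 x2 y1 y2 h x10 x20 y10 y20.
  transitivity (- b * s1 * c * (s2 * s2) / (y1 * y2)); last by ring.
  by rewrite h; field; rewrite x10 x20 y10 y20.
rewrite E2.
have -> : q.+2%:R = q.+1%:R + 1 :> R by rewrite natr1.
have : q.+1%:R + 1 != 0 :> R by rewrite natr1.
move: q.+1%:R n1 => x x0 x1.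
by field; rewrite x0 x1.
Qed.

(** Passes from grouping by the power [q] to grouping by the term [i] of [S], with
    [q = i + k + 1]. *)
Lemma sum_triangle (V : zmodType) (F : nat -> nat -> V) (M : nat) :
  \sum_(q < M.+1) \sum_(i < q) F i q = \sum_(i < M) \sum_(k < M - i) F i (i + k.+1)%N.
Proof.
elim: M => [|M IHM]; first by rewrite big_ord_recr /= !big_ord0 addr0.
rewrite big_ord_recr /= IHM.
have -> : \sum_(i < M.+1) \sum_(k < M.+1 - i) F i (i + k.+1)%N =
    \sum_(i < M.+1) (\sum_(k < M - i) F i (i + k.+1)%N + F i M.+1).
  apply: eq_bigr => i _; have iM : (i <= M)%N by rewrite -ltnS.
  by rewrite subSn // big_ord_recr /= addnS subnKC.
by rewrite big_split /= [in RHS]big_ord_recr /= subnn big_ord0 addr0.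
Qed.

(** The source of the uniformity in [theta]: every later constant depends on [t] only through such
    bounds. *)
Lemma horner_bounded01 (R : realType) (p : {poly R}) :
  exists2 A : R, 0 <= A & forall t, 0 <= t <= 1 -> `|p.[t]| <= A.
Proof.
exists (\sum_(i < size p) `|p`_i|) => [|t /andP[t0 t1]]; first exact: sumr_ge0.
rewrite horner_coef; apply: le_trans (ler_norm_sum _ _ _) _.
by apply: ler_sum => i _; rewrite normrM ler_piMr // normrX ger0_norm ?exprn_ile1.
Qed.

Lemma a_coef_bounded (R : realType) (B : nat -> {poly R}) (n : nat) :
  exists2 A : R, 0 <= A & forall t, 0 <= t <= 1 -> `|a_coef B t n| <= A.
Proof.
have [A A0 hA] := horner_bounded01 (B n.+1).
exists (A / `|n%:R * n.+1%:R|) => [|t ht]; first by rewrite divr_ge0.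
by rewrite /a_coef normrN normrM normfV ler_wpM2r ?invr_ge0 ?hA.
Qed.

(* The increment of [log_mad_ratio t] from [lam] to [lam + 1], where [u = 1 / lam]. *)
Definition stirling_step (R : realType) (t u : R) : R :=
  (u^-1 - t + 3 / 2) * ln (1 + u) - 1 - ln (1 + (1 - t) * u).

(** The logarithm multiplied by [u^-1] is expanded one order further than the others. The constant
    is [4 = 1 + 2 + 1], the middle term using [3 / 2 - t <= 2]. *)
Lemma stirling_step_taylor (R : realType) (M : nat) (t u : R) : 0 <= t <= 1 -> 0 < u ->
  `|stirling_step t u - \sum_(q < M.+1) (-1) ^+ q *
     (- q.+2%:R^-1 + (3 / 2 - t) / q.+1%:R - (1 - t) ^+ q.+1 / q.+1%:R) * u ^+ q.+1|
  <= 4 * u ^+ M.+2.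
Proof.
move=> /andP[t0 t1] u0.
have h1 := ln1Dx_taylor M.+2 (ltW u0); have h2 := ln1Dx_taylor M.+1 (ltW u0).
have x0 : 0 <= (1 - t) * u by rewrite mulr_ge0 ?subr_ge0 // ltW.
have h3 := ln1Dx_taylor M.+1 x0.
have {}h3 : `|ln (1 + (1 - t) * u) -
    \sum_(j < M.+1) (-1) ^+ j * ((1 - t) * u) ^+ j.+1 / j.+1%:R| <= u ^+ M.+2.
  apply: (le_trans h3); apply: lerXn2r; rewrite ?nnegrE ?(ltW u0) //.
  by rewrite ler_piMl ?(ltW u0) // gerBl.
have E1 : u^-1 * \sum_(j < M.+2) (-1) ^+ j * u ^+ j.+1 / j.+1%:R =
    1 + \sum_(q < M.+1) (-1) ^+ q * - q.+2%:R^-1 * u ^+ q.+1.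
  rewrite mulr_sumr big_ord_recl /= expr0 expr1 mul1r divr1 mulVf ?gt_eqF //.
  congr (_ + _); apply: eq_bigr => q _; rewrite /bump /= !add1n !exprS.
  by move: q.+2%:R^-1 (lt0r_neq0 u0) => c un; field.
have E2 : (3 / 2 - t) * \sum_(j < M.+1) (-1) ^+ j * u ^+ j.+1 / j.+1%:R =
    \sum_(q < M.+1) (-1) ^+ q * ((3 / 2 - t) / q.+1%:R) * u ^+ q.+1.
  by rewrite mulr_sumr; apply: eq_bigr => q _; ring.
have E3 : \sum_(j < M.+1) (-1) ^+ j * ((1 - t) * u) ^+ j.+1 / j.+1%:R =
    \sum_(q < M.+1) (-1) ^+ q * ((1 - t) ^+ q.+1 / q.+1%:R) * u ^+ q.+1.
  by apply: eq_bigr => q _; rewrite exprMn; ring.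
have -> : \sum_(q < M.+1) (-1) ^+ q *
     (- q.+2%:R^-1 + (3 / 2 - t) / q.+1%:R - (1 - t) ^+ q.+1 / q.+1%:R) * u ^+ q.+1 =
   u^-1 * \sum_(j < M.+2) (-1) ^+ j * u ^+ j.+1 / j.+1%:R - 1 +
   (3 / 2 - t) * \sum_(j < M.+1) (-1) ^+ j * u ^+ j.+1 / j.+1%:R -
   \sum_(j < M.+1) (-1) ^+ j * ((1 - t) * u) ^+ j.+1 / j.+1%:R.
  have addK (x : R) : 1 + x - 1 = x by ring.
  rewrite E1 E2 E3 addK -big_split -sumrB /=; apply: eq_bigr => q _; ring.
move: h1 h2 h3; rewrite /stirling_step.
set T1 := \sum_(_ < M.+2) _; set T2 := \sum_(_ < M.+1) _; set T3 := \sum_(_ < M.+1) _.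
set L := ln (1 + u); set L' := ln _ => h1 h2 h3.
have -> : (u^-1 - t + 3 / 2) * L - 1 - L' - (u^-1 * T1 - 1 + (3 / 2 - t) * T2 - T3) =
   u^-1 * (L - T1) + (3 / 2 - t) * (L - T2) - (L' - T3) by ring.
apply: le_trans (ler_normB _ _) _; apply: le_trans (lerD (ler_normD _ _) (lexx _)) _.
rewrite !normrM.
have b1 : `|u^-1| * `|L - T1| <= u ^+ M.+2.
  by rewrite gtr0_norm ?invr_gt0 // mulrC ler_pdivrMr // -exprSr.
have b2 : `|3 / 2 - t| * `|L - T2| <= 2 * u ^+ M.+2.
  apply: ler_pM => //; rewrite ler_norml; lra.
by apply: le_trans (lerD (lerD b1 b2) h3) _; lra.
Qed.

Definition log_series (R : realType) (B : nat -> {poly R}) (M : nat) (t u : R) : R :=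
  \sum_(n < M) a_coef B t n.+1 * u ^+ n.+1.

(** Each power of [u / (1 + u)] is expanded by [negpow_taylor]; [sum_triangle] and
    [bernoulli_step_coef] then identify the resulting polynomial with the one in
    [stirling_step_taylor]. *)
Lemma log_series_step_taylor (R : realType) (B : nat -> {poly R}) (M : nat) :
  bernoulli_polynomials B ->
  exists2 C : R, 0 <= C & forall t u : R, 0 <= t <= 1 -> 0 < u ->
  `|log_series B M t (u / (1 + u)) - log_series B M t u - \sum_(q < M.+1) (-1) ^+ q *
     (- q.+2%:R^-1 + (3 / 2 - t) / q.+1%:R - (1 - t) ^+ q.+1 / q.+1%:R) * u ^+ q.+1|
  <= C * u ^+ M.+2.
Proof.
move=> hB.
pose A i := sval (cid2 (a_coef_bounded B i.+1)).
(* The order [(M - i).+1] complements the factor [u ^+ i.+1] to the common error [u ^+ M.+2]. *)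
pose N i := sval (cid2 (negpow_taylor R i (M - i).+1)).
have A0 i : 0 <= A i by rewrite /A; case: cid2.
have N0 i : 0 <= N i by rewrite /N; case: cid2.
exists (\sum_(i < M) A i * N i) => [|t u ht u0].
  by apply: sumr_ge0 => i _; rewrite mulr_ge0.
have -> : \sum_(q < M.+1) (-1) ^+ q *
     (- q.+2%:R^-1 + (3 / 2 - t) / q.+1%:R - (1 - t) ^+ q.+1 / q.+1%:R) * u ^+ q.+1 =
   \sum_(i < M) a_coef B t i.+1 * u ^+ i.+1 *
     (\sum_(k < (M - i).+1) (-1) ^+ k * 'C(i + k, k)%:R * u ^+ k - 1).
  pose F i q := a_coef B t i.+1 * ((-1) ^+ (q - i) * 'C(q, i)%:R) * u ^+ q.+1.
  transitivity (\sum_(q < M.+1) \sum_(i < q) F i q).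
    by apply: eq_bigr => q _; rewrite -(bernoulli_step_coef _ _ hB) mulr_suml.
  rewrite sum_triangle; apply: eq_bigr => i _.
  rewrite big_ord_recl /= bin0 !expr0 !mul1r addrAC subrr add0r mulr_sumr.
  apply: eq_bigr => k _; rewrite /F /bump /= add1n addKn.
  have -> : 'C(i + k.+1, k.+1) = 'C(i + k.+1, i).
    by rewrite -bin_sub ?leq_addl // addnK.
  have -> : u ^+ (i + k.+1).+1 = u ^+ i.+1 * u ^+ k.+1 by rewrite -exprD addSn.
  by ring.
rewrite /log_series -!sumrB mulr_suml.
apply: le_trans (ler_norm_sum _ _ _) _; apply: ler_sum => i _.
set T := \sum_(_ < _) _.
have -> : a_coef B t i.+1 * (u / (1 + u)) ^+ i.+1 - a_coef B t i.+1 * u ^+ i.+1 -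
    a_coef B t i.+1 * u ^+ i.+1 * (T - 1) =
  a_coef B t i.+1 * u ^+ i.+1 * ((1 + u) ^- i.+1 - T) by rewrite exprMn exprVn; ring.
have hA : `|a_coef B t i.+1| <= A i by rewrite /A; case: cid2 => //= ? _; apply.
have hN : `|(1 + u) ^- i.+1 - T| <= N i * u ^+ (M - i).+1.
  by rewrite /N; case: cid2 => //= ? _; apply; exact: ltW.
rewrite !normrM (ger0_norm (exprn_ge0 _ (ltW u0))).
have -> : A i * N i * u ^+ M.+2 = A i * u ^+ i.+1 * (N i * u ^+ (M - i).+1).
  rewrite (_ : M.+2 = i.+1 + (M - i).+1)%N ?exprD; last by have := ltn_ord i; lia.
  by ring.
apply: ler_pM => //; last by rewrite ler_wpM2r // exprn_ge0 // ltW.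
by rewrite mulr_ge0 // exprn_ge0 // ltW.
Qed.

(** * Summation of the increments *)

(* The logarithm of [sqrt (2 pi) lam^(m+1/2) e^(-lam) / m!] at [lam = m + t]. *)
Definition log_mad_ratio (R : realType) (t : R) (m : nat) : R :=
  ln (2 * pi) / 2 + (m%:R + 1 / 2) * ln (m%:R + t) - (m%:R + t) - ln m`!%:R.

Lemma ln_factS (R : realType) (m : nat) : ln m.+1`!%:R = ln m.+1%:R + ln m`!%:R :> R.
Proof. by rewrite factS natrM lnM ?posrE ?ltr0n ?fact_gt0. Qed.

(** With [lam = m + t] and [u = 1 / lam], the two logarithms come from [lam + 1 = lam (1 + u)] and
    [m + 1 = lam (1 + (1 - t) u)]. *)
Lemma log_mad_ratioS (R : realType) (t : R) (m : nat) : 0 <= t <= 1 -> (0 < m)%N ->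
  log_mad_ratio t m.+1 - log_mad_ratio t m = stirling_step t (m%:R + t)^-1.
Proof.
move=> /andP[t0 t1] m0; rewrite /log_mad_ratio /stirling_step ln_factS invrK.
have x0 : 0 < m%:R + t by rewrite ltr_wpDr // ltr0n.
have u0 : 0 < (m%:R + t)^-1 by rewrite invr_gt0.
have xn := lt0r_neq0 x0.
have -> : ln (m.+1%:R + t) = ln (m%:R + t) + ln (1 + (m%:R + t)^-1).
  rewrite -lnM ?posrE // ?addr_gt0 //; congr ln.
  by rewrite mulrDr mulr1 mulfV // -natr1; ring.
have -> : ln m.+1%:R = ln (m%:R + t) + ln (1 + (1 - t) * (m%:R + t)^-1).
  rewrite -lnM ?posrE // ?ltr_pwDl ?mulr_ge0 ?subr_ge0 ?(ltW u0) //; congr ln.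
  by rewrite mulrDr mulr1 mulrCA mulfV // -natr1; ring.
rewrite -natr1.
move: (ln (m%:R + t)) (ln (1 + _)) (ln (1 + _)) (ln m`!%:R) (ln (2 * pi)).
by move=> a b c d e; field.
Qed.

(** With [u = 1 / x] and [v = 1 / (x + 1)] one has [u - v = u v], and [x >= 1] gives [u <= 2 v],
    whence the factor [2]. *)
Lemma inv_pow_telescope (R : realType) (K : nat) (x : R) : 1 <= x ->
  x ^- K.+2 <= 2 * (x ^- K.+1 - (x + 1) ^- K.+1).
Proof.
move=> x1; have x0 : 0 < x by rewrite (lt_le_trans ltr01).
have y0 : 0 < x + 1 by rewrite addr_gt0.
rewrite -!exprVn; set u := x^-1; set v := (x + 1)^-1.
have u0 : 0 < u by rewrite invr_gt0.
have v0 : 0 < v by rewrite invr_gt0.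
have vu : v <= u by rewrite lef_pV2 // lerDl.
have uv : u - v = u * v by rewrite /u /v; field; rewrite ?gt_eqF.
have uv2 : u <= 2 * v.
  have : u * v <= v by rewrite ler_piMl ?(ltW v0) // invf_le1.
  by move: uv; lra.
have h : v ^+ K.+1 <= u ^+ K * v.
  by rewrite exprSr ler_wpM2r ?(ltW v0) // lerXn2r // nnegrE ltW.
apply: (@le_trans _ _ (2 * (u ^+ K * (u - v)))).
  rewrite uv (_ : 2 * _ = u ^+ K * u * (2 * v)); last by ring.
  by rewrite !exprSr ler_wpM2l // mulr_ge0 ?exprn_ge0 // ltW.
by rewrite ler_pM2l // mulrBr -exprSr; lra.
Qed.

Lemma telescope_bound (R : realType) (f : nat -> R) (C t : R) (K m k : nat) :
  0 <= t -> (0 < m)%N ->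
  (forall n, (0 < n)%N -> `|f n.+1 - f n| <= C * (n%:R + t) ^- K.+2) ->
  `|f (m + k)%N - f m| <= 2 * C * (m%:R + t) ^- K.+1.
Proof.
move=> t0 m0 hf.
have C0 : 0 <= C.
  have := le_trans (normr_ge0 _) (hf m m0); rewrite pmulr_lge0 // invr_gt0.
  by rewrite exprn_gt0 // ltr_wpDr // ltr0n.
(* Keeping the subtracted term lets the induction on [k] absorb each new increment. *)
have key : `|f (m + k)%N - f m| <=
    2 * C * ((m%:R + t) ^- K.+1 - ((m + k)%:R + t) ^- K.+1).
  elim: k => [|k IHk]; first by rewrite addn0 !subrr normr0 mulr0.
  rewrite addnS; have mk0 : (0 < m + k)%N by rewrite ltn_addr.
  have -> : f (m + k).+1 - f m = (f (m + k).+1 - f (m + k)%N) + (f (m + k)%N - f m).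
    by ring.
  apply: le_trans (ler_normD _ _) _; apply: le_trans (lerD (hf _ mk0) IHk) _.
  have x1 : 1 <= (m + k)%:R + t by rewrite ler_wpDr // ler1n.
  have := ler_wpM2l C0 (inv_pow_telescope K x1).
  rewrite -[(m + k).+1%:R]natr1 [_ + 1 + t]addrAC.
  by set a := (_ ^- _); set b := (_ ^- _); set c := (_ ^- _); nra.
apply: le_trans key _; rewrite ler_wpM2l ?mulr_ge0 // gerBl invr_ge0.
by rewrite exprn_ge0 // addr_ge0.
Qed.

(** Both increments have the same Taylor polynomial, so their difference is [O(u^(M+2))] and sums to
    [O(u^(M+1))], uniformly in [k]. *)
Lemma log_mad_ratio_increment (R : realType) (B : nat -> {poly R}) (M : nat) :
  bernoulli_polynomials B ->
  exists2 C : R, 0 <= C & forall (t : R) (m k : nat), 0 <= t <= 1 -> (0 < m)%N ->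
  `|(log_mad_ratio t (m + k) - log_series B M t ((m + k)%:R + t)^-1) -
    (log_mad_ratio t m - log_series B M t (m%:R + t)^-1)| <= C * (m%:R + t) ^- M.+1.
Proof.
move=> hB; have [C C0 hC] := log_series_step_taylor M hB.
exists (2 * (4 + C)) => [|t m k ht m0]; first by rewrite mulr_ge0 // addr_ge0.
have t0 : 0 <= t by case/andP: ht.
apply: (telescope_bound (f := fun n => log_mad_ratio t n - log_series B M t (n%:R + t)^-1)
  k t0 m0) => n n0.
have x0 : 0 < n%:R + t by rewrite ltr_wpDr // ltr0n.
have u0 : 0 < (n%:R + t)^-1 by rewrite invr_gt0.
have E : (n.+1%:R + t)^-1 = (n%:R + t)^-1 / (1 + (n%:R + t)^-1).
  rewrite -invfM mulrDr mulr1 mulfV ?lt0r_neq0 // -natr1; congr (_^-1); ring.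
have := hC t _ ht u0; have := stirling_step_taylor M ht u0.
rewrite E -exprVn -(log_mad_ratioS ht n0) (mulrDl 4 C).
set S := \sum_(_ < _) _; set g1 := log_mad_ratio t n.+1; set g0 := log_mad_ratio t n.
set s1 := log_series B M t _; set s0 := log_series B M t _ => h1 h2.
have -> : g1 - s1 - (g0 - s0) = (g1 - g0 - S) - (s1 - s0 - S) by ring.
by apply: le_trans (ler_normB _ _) _; exact: lerD.
Qed.

(** * The limit of the logarithm, from Wallis' product *)

(** A sequence [g] with a limit has the same limit as [2 g(n) - g(2n)]; in this combination only the
    Wallis quantity survives. *)
Lemma log_mad_ratio_double (R : realType) (n : nat) : (0 < n)%N ->
  2 * log_mad_ratio 0 n - log_mad_ratio 0 n.*2 =
  ln (pi * n%:R * central_ratio R n ^+ 2) / 2.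
Proof.
move=> n0; rewrite /log_mad_ratio /central_ratio !addr0.
have p0 := pi_gt0 R.
have n0' : 0 < n%:R :> R by rewrite ltr0n.
have f0 k : 0 < k`!%:R :> R by rewrite ltr0n fact_gt0.
have l4 : ln (4 ^+ n) = n%:R * (2 * ln 2) :> R.
  have four : 4 = 2 * 2 :> R by ring.
  have ln4 : ln 4 = ln 2 + ln 2 :> R by rewrite four lnM // posrE.
  by rewrite lnXn // -[RHS]/(n%:R * (2 * ln 2)) -(mulr_natl (ln 4) n) ln4; congr (_ * _); ring.
have lr : ln (n.*2`!%:R / (4 ^+ n * n`!%:R ^+ 2)) =
    ln n.*2`!%:R - (n%:R * (2 * ln 2) + 2 * ln n`!%:R) :> R.
  rewrite ln_div ?posrE // ?mulr_gt0 ?exprn_gt0 //.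
  by rewrite (lnM (x := 4 ^+ n)) ?posrE ?exprn_gt0 // l4 (lnXn 2) //; ring.
have r0 : 0 < n.*2`!%:R / (4 ^+ n * n`!%:R ^+ 2) :> R.
  by rewrite divr_gt0 // mulr_gt0 // exprn_gt0.
move: lr r0; set r := n.*2`!%:R / _ => lr r0.
have -> : ln (pi * n%:R * r ^+ 2) = ln pi + ln n%:R + 2 * ln r.
  rewrite lnM ?posrE ?mulr_gt0 ?exprn_gt0 // (lnXn 2) // (lnM (x := pi)) ?posrE //.
  by move: (ln pi) (ln n%:R) (ln r) => a b c; ring.
rewrite lr.
have -> : ln n.*2%:R = ln 2 + ln n%:R :> R by rewrite -mul2n natrM lnM ?posrE.
have -> : n.*2%:R = 2 * n%:R :> R by rewrite -mul2n natrM.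
rewrite lnM ?posrE //.
move: n%:R (ln n`!%:R) (ln n.*2`!%:R) (ln n%:R) (ln 2) (ln pi) => a b c d e f.
by field.
Qed.

Lemma ln_ge1BV (R : realType) (x : R) : 0 < x -> 1 - x^-1 <= ln x.
Proof.
move=> x0; have := @le_ln1Dx R (x^-1 - 1).
rewrite addrCA subrr addr0 lnV ?posrE // => h.
have : -1 < x^-1 - 1 by rewrite ltrBrDr addNr invr_gt0.
by move=> /h; lra.
Qed.

(** With [y = t / n] and [L = ln (1 + y)] the difference is [n (L - y) + L / 2], and each summand is
    at most [1 / n] in absolute value. *)
Lemma log_mad_ratio_shift (R : realType) (t : R) (n : nat) : 0 <= t <= 1 -> (0 < n)%N ->
  `|log_mad_ratio t n - log_mad_ratio 0 n| <= 2 / n%:R.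
Proof.
move=> /andP[t0 t1] n0; have x0 : 0 < n%:R :> R by rewrite ltr0n.
rewrite /log_mad_ratio !addr0.
have -> : ln (n%:R + t) = ln n%:R + ln (1 + t / n%:R).
  rewrite -lnM ?posrE // ?ltr_pwDl ?divr_ge0 //; congr ln.
  by rewrite mulrDr mulr1 mulrCA mulfV ?mulr1 // lt0r_neq0.
have y0 : 0 <= t / n%:R by rewrite divr_ge0.
have := ln1Dx_taylor 1 y0; rewrite big_ord_recr big_ord0 /= add0r expr0 expr1 mul1r divr1.
have := le_ln1Dx (lt_le_trans (ltrN10 R) y0).
have : 0 <= ln (1 + t / n%:R) by rewrite ln_ge0 // lerDl.
set L := ln (1 + _); set y := t / n%:R => L0 Ly hL.
have -> : ln (2 * pi) / 2 + (n%:R + 1 / 2) * (ln n%:R + L) - (n%:R + t) - ln n`!%:R -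
    (ln (2 * pi) / 2 + (n%:R + 1 / 2) * ln n%:R - n%:R - ln n`!%:R) =
    n%:R * (L - y) + 1 / 2 * L.
  have -> : t = n%:R * y by rewrite /y mulrCA mulfV ?mulr1 // lt0r_neq0.
  by move: n%:R (ln n`!%:R) (ln (2 * pi)) (ln n%:R) => a b c d; field.
have yn : y <= n%:R^-1 by rewrite /y ler_piMl // invr_ge0 ltW.
have e1 : `|n%:R * (L - y)| <= n%:R^-1.
  rewrite normrM (gtr0_norm x0) mulrC -ler_pdivlMr //; apply: le_trans hL _.
  by rewrite -expr2 lerXn2r // nnegrE invr_ge0 ltW.
have e2 : `|1 / 2 * L| <= n%:R^-1.
  by rewrite ger0_norm; lra.
by apply: le_trans (ler_normD _ _) _; apply: le_trans (lerD e1 e2) _; lra.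
Qed.

Lemma log_mad_ratio_bound (R : realType) (B : nat -> {poly R}) :
  bernoulli_polynomials B ->
  exists2 C : R, 0 <= C & forall (t : R) (n : nat), 0 <= t <= 1 -> (0 < n)%N ->
  `|log_mad_ratio t n| <= C / n%:R.
Proof.
move=> hB; have [C C0 hC] := log_mad_ratio_increment 0 hB.
exists (C + 3) => [|t n ht n0]; first by rewrite addr_ge0.
have x0 : 0 < n%:R :> R by rewrite ltr0n.
(* For [M = 0] the series is empty, and [k = n] compares the values at [n] and [2n]. In [C + 3], the
   shift in [t] accounts for [2] and Wallis for [1]. *)
have := hC 0 n n _ n0; rewrite lexx ler01 /log_series !big_ord0 !subr0 addr0 expr1.
move=> /(_ isT); rewrite addnn => h1.
have := log_mad_ratio_shift ht n0; have := log_mad_ratio_double R n0.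
have /andP[b1 b2] := @central_ratio_bounds R n n0.
have y0 : 0 < n.*2%:R / n.*2.+1%:R :> R by rewrite divr_gt0 ?ltr0n ?double_gt0.
have c0 := lt_le_trans y0 b1.
have : ln (pi * n%:R * central_ratio R n ^+ 2) <= 0 by exact: ln_le0.
have : - n%:R^-1 <= ln (pi * n%:R * central_ratio R n ^+ 2).
  apply: le_trans (ln_ge1BV c0).
  have : (pi * n%:R * central_ratio R n ^+ 2)^-1 <= (n.*2%:R / n.*2.+1%:R)^-1.
    by rewrite lef_pV2.
  have -> : (n.*2%:R / n.*2.+1%:R)^-1 = 1 + n%:R^-1 / 2 :> R.
    rewrite invf_div -natr1 -mul2n natrM.
    by move: n%:R (lt0r_neq0 x0) => x xn; field.
  have : 0 < n%:R^-1 :> R by rewrite invr_gt0.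
  lra.
set L := ln _ => L1 L2 E hs.
have -> : log_mad_ratio t n = (log_mad_ratio t n - log_mad_ratio 0 n) +
   (L / 2 + (log_mad_ratio 0 n.*2 - log_mad_ratio 0 n)) by rewrite -E; ring.
apply: le_trans (ler_normD _ _) _; apply: le_trans (lerD hs (ler_normD _ _)) _.
have hL : `|L / 2| <= n%:R^-1 by rewrite ler_norml; lra.
by apply: le_trans (lerD (lexx _) (lerD hL h1)) _; lra.
Qed.

Lemma log_series_bound (R : realType) (B : nat -> {poly R}) (M : nat) :
  exists2 A : R, 0 <= A & forall t u : R, 0 <= t <= 1 -> 0 <= u <= 1 ->
  `|log_series B M t u| <= A * u.
Proof.
pose A i := sval (cid2 (a_coef_bounded B i.+1)).
have A0 i : 0 <= A i by rewrite /A; case: cid2.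
exists (\sum_(i < M) A i) => [|t u ht /andP[u0 u1]]; first exact: sumr_ge0.
rewrite mulr_suml; apply: le_trans (ler_norm_sum _ _ _) _; apply: ler_sum => i _.
have hA : `|a_coef B t i.+1| <= A i by rewrite /A; case: cid2 => //= ? _; apply.
by rewrite normrM normrX (ger0_norm u0) ler_pM ?exprn_ge0 // exprS ler_piMr ?exprn_ile1.
Qed.

(** The increment from [m] to [m + k] is bounded uniformly in [k], while both quantities at [m + k]
    tend to [0] as [k] grows. *)
Lemma log_mad_ratio_expansion (R : realType) (B : nat -> {poly R}) (M : nat) :
  bernoulli_polynomials B ->
  exists2 C : R, 0 <= C & forall (t : R) (m : nat), 0 <= t <= 1 -> (0 < m)%N ->
  `|log_mad_ratio t m - log_series B M t (m%:R + t)^-1| <= C * (m%:R + t) ^- M.+1.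
Proof.
move=> hB; have [C C0 hC] := log_mad_ratio_increment M hB.
exists C => // t m ht m0; have [C1 C10 hC1] := log_mad_ratio_bound hB.
have [A A0 hA] := log_series_bound B M.
apply/ler_addgt0Pl => e e0.
have [k hk] : exists k : nat, (C1 + A) / e <= k%:R.
  by exists (Num.truncn ((C1 + A) / e)).+1; apply/ltW/truncnS_gt.
have mk : (0 < m + k)%N by rewrite ltn_addr.
have ke : (C1 + A) / (m + k)%:R <= e.
  rewrite ler_pdivrMr ?ltr0n // mulrC -ler_pdivrMr //.
  by apply: le_trans hk _; rewrite ler_nat leq_addl.
have t0 : 0 <= t by case/andP: ht.
have x0 : 0 < (m + k)%:R :> R by rewrite ltr0n.
have v0 : 0 < ((m + k)%:R + t)^-1 by rewrite invr_gt0 ltr_wpDr.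
have vx : ((m + k)%:R + t)^-1 <= (m + k)%:R^-1.
  by rewrite lef_pV2 ?posrE ?ltr_wpDr // lerDl.
have v1 : ((m + k)%:R + t)^-1 <= 1.
  by apply: le_trans vx _; rewrite invf_le1 // ler1n.
have := hA t _ ht (_ : 0 <= ((m + k)%:R + t)^-1 <= 1); rewrite (ltW v0) v1 => /(_ isT) h1.
have h2 := hC1 t _ ht mk; have h3 := hC t m k ht m0.
have h1' := le_trans h1 (ler_wpM2l A0 vx).
move: h2 h3 h1'; set g1 := log_mad_ratio t (m + k); set g0 := log_mad_ratio t m.
set s1 := log_series _ _ _ _; set s0 := log_series _ _ _ _ => h2 h3 h4.
have -> : g0 - s0 = (g1 - s1) - ((g1 - s1) - (g0 - s0)) by ring.
apply: le_trans (ler_normB _ _) _; apply: lerD => //.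
apply: le_trans (ler_normB _ _) _; apply: le_trans (lerD h2 h4) _.
by rewrite -mulrDl.
Qed.

(** * Exponentiation of the truncated series *)

(** The recursion for [exp_coef] has nonnegative weights, so a constant majorant of [a] yields a
    majorant of the coefficients that no longer depends on [theta]. *)
Lemma exp_coef_le (R : realType) (a : nat -> R) (A : R) (M n : nat) :
  (forall k, (0 < k <= M)%N -> `|a k| <= A) -> (n <= M)%N ->
  `|exp_coef a n| <= exp_coef (fun=> A) n.
Proof.
move=> ha; elim/ltn_ind: n => -[|n] IHn nM; first by rewrite normr1.
rewrite !exp_coefS // normrM normfV normr_nat ler_wpM2l //.
apply: le_trans (ler_norm_sum _ _ _) _; rewrite !big_nat; apply: ler_sum => k /andP[k0 kn].
rewrite !normrM normr_nat; apply: ler_pM => //.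
  by rewrite ler_wpM2l // ha // k0 (leq_trans _ nM).
by apply: IHn; rewrite ?(leq_trans _ nM) ?leq_subr //; lia.
Qed.

Lemma is_derive_horner (R : realType) (p : {poly R}) (x : R) :
  is_derive x 1 (horner p) (p^`()).[x].
Proof.
by apply: DeriveDef; [exact: derivable_horner|rewrite -derive1E -derivE].
Qed.

Lemma horner_norm_le (R : realType) (p q : {poly R}) (M : nat) (u : R) :
  0 <= u <= 1 -> (forall k, (k < M)%N -> p`_k = 0) -> (forall k, `|p`_k| <= q`_k) ->
  `|p.[u]| <= u ^+ M * q.[1].
Proof.
move=> /andP[u0 u1] p0 pq.
rewrite (horner_coef_wide _ (leq_maxl (size p) (size q))).
rewrite (horner_coef_wide _ (leq_maxr (size p) (size q))).
apply: le_trans (ler_norm_sum _ _ _) _; rewrite mulr_sumr; apply: ler_sum => k _.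
rewrite expr1n mulr1 normrM normrX (ger0_norm u0) mulrC.
have [kM|Mk] := ltnP k M.
  by rewrite p0 // normr0 mulr0 mulr_ge0 ?exprn_ge0 // (le_trans _ (pq k)).
by rewrite ler_pM ?exprn_ge0 // ler_wiXn2l.
Qed.

Definition trunc_series (R : realType) (a : nat -> R) (M : nat) : {poly R} :=
  \poly_(k < M.+1) (if k is 0 then 0 else a k).

Definition trunc_exp_series (R : realType) (a : nat -> R) (M : nat) : {poly R} :=
  \poly_(k < M.+1) exp_coef a k.

(* The formal identity [D' = D S'] for [D = exp S], up to the truncation order. *)
Lemma trunc_exp_series_deriv (R : realType) (a : nat -> R) (M k : nat) : (k < M)%N ->
  ((trunc_exp_series a M)^`() - trunc_exp_series a M * (trunc_series a M)^`())`_k = 0.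
Proof.
move=> kM; rewrite coefB coef_deriv coefMr coef_poly ltnS kM -mulr_natl exp_coefS //.
rewrite mulrA mulfV ?pnatr_eq0 // mul1r big_add1 big_mkord; apply/eqP.
rewrite subr_eq0; apply/eqP; apply: eq_bigr => j _.
have jk : (j <= k)%N by rewrite -ltnS.
rewrite coef_deriv !coef_poly !ltnS (leq_trans (leq_subr _ _) (ltnW kM)).
by rewrite (leq_ltn_trans jk kM) subSS -mulr_natl; ring.
Qed.

(** For [h = p e^(-s)], [h' = (p' - p s') e^(-s)] has a polynomial factor vanishing to order [M].
    Since [h 0 = 1], the mean value theorem gives [h u - 1 = O(u^(M+1))], and it remains to multiply
    by [e^s]. *)
Lemma trunc_exp_series_approx (R : realType) (A : R) (M : nat) : 0 <= A ->
  exists2 C : R, 0 <= C & forall (a : nat -> R) (u : R),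
  (forall k, (0 < k <= M)%N -> `|a k| <= A) -> 0 <= u <= 1 ->
  `|expR (trunc_series a M).[u] - (trunc_exp_series a M).[u]| <= C * u ^+ M.+1.
Proof.
move=> A0; pose sA := trunc_series (fun=> A) M; pose pA := trunc_exp_series (fun=> A) M.
(* A plus sign replaces the minus of [p' - p s'], so that [Q] dominates it coefficientwise for every
   [a] bounded by [A]. *)
pose Q := pA^`() + pA * sA^`().
have sA1 (a : nat -> R) u : (forall k, (0 < k <= M)%N -> `|a k| <= A) -> 0 <= u <= 1 ->
    `|(trunc_series a M).[u]| <= sA.[1].
  move=> ha hu; have := @horner_norm_le R (trunc_series a M) sA 0 u hu.
  rewrite expr0 mul1r; apply => // k; rewrite !coef_poly; case: ltnP; rewrite ?normr0 //.
  by case: k => [|k] kM; rewrite ?normr0 // ha.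
exists (expR (sA.[1]) * (expR (sA.[1]) * `|Q.[1]|)) => [|a u ha hu].
  by rewrite !mulr_ge0 ?expR_ge0.
set s := trunc_series a M; set p := trunc_exp_series a M.
pose q := p^`() - p * s^`().
have ps k : `|p`_k| <= pA`_k.
  rewrite !coef_poly; case: ltnP; rewrite ?normr0 // ltnS => kM.
  exact: exp_coef_le ha kM.
have ss k : `|s`_k| <= sA`_k.
  rewrite !coef_poly; case: ltnP; rewrite ?normr0 //.
  by case: k => [|k] kM; rewrite ?normr0 // ha.
have qQ k : `|q`_k| <= Q`_k.
  rewrite coefB coefD !coefM !coef_deriv; apply: le_trans (ler_normB _ _) _.
  apply: lerD; first by rewrite normrMn lerMn2r ps orbT.
  apply: le_trans (ler_norm_sum _ _ _) _; apply: ler_sum => i _.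
  by rewrite normrM !coef_deriv normrMn ler_pM // lerMn2r ss orbT.
pose h (x : R) := p.[x] * expR (- s.[x]).
have dh (x : R) : is_derive x 1 h (q.[x] * expR (- s.[x])).
  have D1 := is_derive_horner p x; have D2 := is_derive_horner (- s) x.
  have D3 := is_derive1_comp (is_derive_expR (- s).[x]) D2.
  have -> : h = horner p * (expR \o horner (- s)).
    by apply/funext => y; rewrite /h /= !fctE /= hornerN.
  apply: is_derive_eq; rewrite /q /= derivN !hornerE /GRing.scale /=; ring.
have h0 : h 0 = 1.
  by rewrite /h !horner_coef0 !coef_poly /= exp_coef0 oppr0 expR0 mulr1.
have /andP[u0 u1] := hu.
have [c] : exists2 c, c \in `[0, u]%R & h u - h 0 = q.[c] * expR (- s.[c]) * (u - 0).
  apply: MVT_segment => //.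
  by apply: derivable_within_continuous => y _; have [] := dh y.
rewrite in_itv /= subr0 h0 => /andP[c0 cu] hE.
have hc : 0 <= c <= 1 by rewrite c0 (le_trans cu).
have es x : 0 <= x <= 1 -> expR (- s.[x]) <= expR sA.[1].
  by move=> hx; rewrite ler_expR; apply: le_trans (ler_norm _) _; rewrite normrN sA1.
have -> : expR s.[u] - p.[u] = - (expR s.[u] * (h u - 1)).
  by rewrite /h mulrBr mulrCA -expRD subrr expR0; ring.
rewrite hE normrN !normrM (ger0_norm u0) !(ger0_norm (expR_ge0 _)) -!mulrA.
apply: ler_pM; rewrite ?expR_ge0 ?mulr_ge0 ?expR_ge0 //.
  by rewrite ler_expR; apply: le_trans (ler_norm _) _; exact: sA1.
have hq := horner_norm_le hc (@trunc_exp_series_deriv R a M) qQ.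
have hq' : `|q.[c]| <= u ^+ M * `|Q.[1]|.
  apply: le_trans hq (le_trans (ler_wpM2l (exprn_ge0 _ c0) (ler_norm _)) _).
  by rewrite ler_wpM2r // lerXn2r.
rewrite mulrA exprSr mulrA mulrA ler_wpM2r //.
rewrite mulrC -mulrA; apply: ler_pM; rewrite ?expR_ge0 //; first exact: es.
by rewrite mulrC.
Qed.

(** After factoring out [expR y], both signs of [expR z - 1] follow from [1 + z <= expR z], applied
    at [z] and at [- z]. *)
Lemma expR_norm_sub_le (R : realType) (x y : R) :
  `|expR x - expR y| <= expR y * (`|x - y| * expR `|x - y|).
Proof.
have -> : expR x - expR y = expR y * (expR (x - y) - 1).
  by rewrite mulrBr mulr1 -expRD addrCA subrr addr0.
rewrite normrM (ger0_norm (expR_ge0 _)) ler_wpM2l ?expR_ge0 //.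
move: (x - y) => z; rewrite ler_norml; apply/andP; split.
  apply: (@le_trans _ _ (- `|z|)).
    by rewrite lerN2 ler_peMr // -expR0 ler_expR.
  have := expR_ge1Dx z; have := ler_norm (- z); rewrite normrN; lra.
apply: (@le_trans _ _ (z * expR z)).
  have := expR_ge1Dx (- z); rewrite expRN => h.
  have := ler_wpM2r (expR_ge0 z) h; rewrite mulVf ?gt_eqF ?expR_gt0 //; lra.
apply: (@le_trans _ _ (`|z| * expR z)); first by rewrite ler_wpM2r ?expR_ge0 ?ler_norm.
by rewrite ler_wpM2l // ler_expR ler_norm.
Qed.

(** * From the logarithm back to the mean deviation *)

Lemma poisson_mad_ratioE (R : realType) (t : R) (m : nat) : 0 < m%:R + t ->
  2 * (m%:R + t) * poisson_pmf (m%:R + t) m / Num.sqrt (2 * (m%:R + t) / pi) =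
  expR (log_mad_ratio t m).
Proof.
move=> x0; rewrite poisson_pmfE //; set x := m%:R + t in x0 *.
have p0 := pi_gt0 R.
have f0 : 0 < m`!%:R :> R by rewrite ltr0n fact_gt0.
have y0 : 0 < 2 * x / pi by rewrite divr_gt0 // mulr_gt0.
have s0 : 0 < Num.sqrt (2 * x / pi) by rewrite sqrtr_gt0.
have ls : ln (Num.sqrt (2 * x / pi)) = (ln 2 + ln x - ln pi) / 2.
  have : ln (Num.sqrt (2 * x / pi) ^+ 2) = ln (2 * x / pi) by rewrite sqr_sqrtr // ltW.
  rewrite (lnXn 2) // ln_div ?posrE ?mulr_gt0 // (lnM (x := 2)) ?posrE // => h; lra.
have xm : 0 < x ^+ m by rewrite exprn_gt0.
have w0 : 0 < x ^+ m / m`!%:R by rewrite divr_gt0.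
have z0 : 0 < x ^+ m / m`!%:R * expR (- x) by rewrite mulr_gt0 ?expR_gt0.
have F0 : 0 < 2 * x * (x ^+ m / m`!%:R * expR (- x)).
  by apply: mulr_gt0 => //; apply: mulr_gt0.
have FS0 := divr_gt0 F0 s0.
rewrite -[LHS]lnK ?posrE //; congr expR.
rewrite ln_div ?posrE // ls lnM ?posrE //; last exact: mulr_gt0.
rewrite (lnM (x := 2)) ?posrE //.
rewrite lnM ?posrE ?expR_gt0 // expRK ln_div ?posrE // lnXn //.
rewrite /log_mad_ratio -/x (lnM (x := 2)) ?posrE // -(mulr_natl (ln x) m).
move: (ln 2) (ln x) (ln pi) (ln m`!%:R) => a b c d.
by field.
Qed.

Lemma log_seriesE (R : realType) (B : nat -> {poly R}) (M : nat) (t u : R) :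
  log_series B M t u = (trunc_series (a_coef B t) M).[u].
Proof. by rewrite horner_poly big_ord_recl /= mul0r add0r. Qed.

Lemma a_coef_bounded_upto (R : realType) (B : nat -> {poly R}) (M : nat) :
  exists2 A : R, 0 <= A & forall t k, 0 <= t <= 1 -> (0 < k <= M)%N -> `|a_coef B t k| <= A.
Proof.
elim: M => [|M [A A0 hA]]; first by exists 0 => // t [|k] //.
have [A1 A10 hA1] := a_coef_bounded B M.+1.
exists (A + A1) => [|t k ht /andP[k0]]; first exact: addr_ge0.
rewrite leq_eqVlt => /orP[/eqP ->|kM]; first by rewrite ler_wpDl // hA1.
by rewrite ler_wpDr // hA // k0.
Qed.

(** Splits [e^g - P] as [(e^g - e^S) + (e^S - P)]. As [u <= 1], the bounds [A1] on [S] and [C1] on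
    [g - S] keep the exponential factors constant. *)
Lemma mad_ratio_expansion_ge1 (R : realType) (B : nat -> {poly R}) (M : nat) :
  bernoulli_polynomials B ->
  exists2 C : R, 0 <= C & forall (t : R) (m : nat), 0 <= t <= 1 -> (0 < m)%N ->
  `|expR (log_mad_ratio t m) -
    \sum_(0 <= n < M.+1) d_coef B t n / (m%:R + t) ^+ n| <= C * (m%:R + t) ^- M.+1.
Proof.
move=> hB; have [A A0 hA] := a_coef_bounded_upto B M.
have [C1 C10 h1] := log_mad_ratio_expansion M hB.
have [C2 C20 h2] := trunc_exp_series_approx M A0.
have [A1 A10 hA1] := log_series_bound B M.
exists (expR A1 * (C1 * expR C1) + C2) => [|t m ht m0].
  by rewrite addr_ge0 // !mulr_ge0 ?expR_ge0.
have t0 : 0 <= t by case/andP: ht.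
have x1 : 1 <= m%:R + t by rewrite ler_wpDr // ler1n.
have x0 : 0 < m%:R + t by exact: lt_le_trans x1.
have hu : 0 <= (m%:R + t)^-1 <= 1 by rewrite invr_ge0 (ltW x0) invf_le1.
have := h1 t m ht m0; have := h2 _ _ (fun k => hA t k ht) hu; have := hA1 t _ ht hu.
rewrite log_seriesE !horner_poly.
rewrite -!exprVn; move: hu; set u := (m%:R + t)^-1 => /andP[u0 u1].
have -> : \sum_(0 <= n < M.+1) d_coef B t n / (m%:R + t) ^+ n =
    \sum_(n < M.+1) exp_coef (a_coef B t) n * u ^+ n.
  by rewrite big_mkord; apply: eq_bigr => n _; rewrite exprVn.
set g := log_mad_ratio t m; set P := \sum_(n < M.+1) exp_coef _ _ * _.
set S := \sum_(_ < _) _ => hS hP hg.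
have uM : u ^+ M.+1 <= 1 by rewrite exprn_ile1.
have -> : expR g - P = (expR g - expR S) + (expR S - P) by ring.
apply: le_trans (ler_normD _ _) _; rewrite mulrDl; apply: lerD => //.
apply: le_trans (expR_norm_sub_le _ _) _.
rewrite -mulrA; apply: ler_pM; rewrite ?expR_ge0 ?mulr_ge0 ?expR_ge0 //.
  rewrite ler_expR; apply: le_trans (ler_norm _) _; apply: le_trans hS _.
  by rewrite ler_piMr.
rewrite mulrAC; apply: ler_pM; rewrite ?expR_ge0 // ler_expR.
by apply: le_trans hg _; rewrite ler_piMr.
Qed.

(** Covers [lam < 1], where no asymptotics is involved: [sqrt (2 pi t) e^(-t)] is bounded, and each
    power [t ^- n] with [n <= M] is at most [t ^- M.+1]. This frees the final constant from
    [lam0]. *)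
Lemma mad_ratio_expansion_lt1 (R : realType) (B : nat -> {poly R}) (M : nat) :
  exists2 C : R, 0 <= C & forall t : R, 0 < t <= 1 ->
  `|expR (log_mad_ratio t 0) - \sum_(0 <= n < M.+1) d_coef B t n / t ^+ n| <= C * t ^- M.+1.
Proof.
have [A A0 hA] := a_coef_bounded_upto B M.
have d0 n : (n <= M)%N -> 0 <= exp_coef (fun=> A) n.
  move=> nM; apply: le_trans (normr_ge0 _) (exp_coef_le (a := fun=> A) _ nM).
  by move=> k _; rewrite ger0_norm.
exists (expR (ln (2 * pi) / 2) + \sum_(0 <= n < M.+1) exp_coef (fun=> A) n) => [|t].
  rewrite addr_ge0 ?expR_ge0 // big_nat sumr_ge0 // => n; rewrite ltnS; exact: d0.
move=> /andP[t0 t1]; have ht : 0 <= t <= 1 by rewrite ltW.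
have v1 : 1 <= t^-1 by rewrite invf_ge1.
apply: le_trans (ler_normB _ _) _; rewrite mulrDl -exprVn; apply: lerD.
  rewrite ger0_norm ?expR_ge0 //; apply: (@le_trans _ _ (expR (ln (2 * pi) / 2))).
    rewrite ler_expR /log_mad_ratio fact0 ln1 !add0r.
    have := ln_sublinear t0; have := ltW t0; have := ln_le0 t1; lra.
  by rewrite ler_peMr ?expR_ge0 // exprn_ege1.
apply: le_trans (ler_norm_sum _ _ _) _; rewrite mulr_suml !big_nat.
apply: ler_sum => n /andP[_ nM]; rewrite normrM normfV normrX (gtr0_norm t0) -exprVn.
apply: ler_pM; rewrite ?exprn_ge0 ?invr_ge0 ?(ltW t0) //.
  by apply: (@exp_coef_le _ (a_coef B t) A M) => // k; exact: hA.
by rewrite ler_weXn2l // ltnW.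
Qed.

Theorem theorem4p1 (R : realType) (B : nat -> {poly R})
    (hB : bernoulli_polynomials B) :
  (forall M : nat, exists C : R,
    forall lam0 : R, 0 < lam0 -> forall lam : R, lam0 <= lam ->
    forall (d : measure_display) (T : measurableType d) (P : probability T R)
      (X : {RV P >-> nat}),
    (forall k : nat, P [set w | X w = k] = (poisson_pmf lam k)%:E) ->
    (`| 'E_P[fun w => `|(X w)%:R - lam|%R]
          * ((Num.sqrt (2 * lam / pi))^-1)%:E
        - (\sum_(0 <= n < M.+1) d_coef B (fracpart lam) n / lam ^+ n)%:E |
      <= (C * lam ^- M.+1)%:E)%E) /\
  (forall theta : R, 0 <= theta < 1 ->
    d_coef B theta 1 = - (1 / 2) * (B 2%N).[theta] /\
    d_coef B theta 2 = - (1 / 6) * (B 3%N).[theta] + 1 / 8 * (B 2%N).[theta] ^+ 2).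
Proof.
split=> [M|theta _]; last first.
  rewrite /d_coef; set a := a_coef B theta.
  have d1 : exp_coef a 1 = a 1%N.
    by rewrite exp_coefS // big_nat1 subnn exp_coef0 invr1 !mul1r mulr1.
  rewrite d1; split; first by rewrite /a /a_coef; field.
  rewrite exp_coefS // big_ltn // big_nat1 subnn d1 exp_coef0 /a /a_coef.
  by field.
have [C1 C10 h1] := mad_ratio_expansion_ge1 M hB.
have [C2 C20 h2] := mad_ratio_expansion_lt1 B M.
exists (C1 + C2) => lam0 lam00 lam le_lam d T P X PX.
have lam_gt0 : 0 < lam by exact: lt_le_trans le_lam.
pose m := Num.truncn lam.
have mlam : m%:R <= lam by rewrite truncn_le // ltW.
have lamm : lam < m.+1%:R by exact: truncnS_gt.
have fE : fracpart lam = lam - m%:R.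
  rewrite /fracpart (@floor_def _ _ m) //.
  by rewrite intrD -!pmulrn mlam natr1.
have lamE : lam = m%:R + fracpart lam by rewrite fE addrC subrK.
have ht : 0 <= fracpart lam <= 1.
  by rewrite fE subr_ge0 mlam lerBlDr addrC natr1 ltW.
rewrite (poisson_mean_abs_dev lam_gt0 mlam lamm PX) -EFinM -EFinB /= lee_fin.
have E := @poisson_mad_ratioE R (fracpart lam) m; rewrite -lamE in E.
rewrite E // {E}; have u0 : 0 <= lam ^- M.+1 by rewrite invr_ge0 exprn_ge0 // ltW.
(* For [m = 0] the fractional part is [lam] itself and the bound for small [lam] applies; otherwise
   [lam >= 1]. *)
have [m0|m0] := posnP m.
  have tl : fracpart lam = lam by rewrite fE m0 subr0.
  have := h2 lam; rewrite tl m0 lam_gt0 -{1}tl; case/andP: ht => _ -> /(_ isT) h.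
  by apply: le_trans h _; rewrite ler_wpM2r // lerDr.
have := h1 _ _ ht m0; rewrite -lamE => h.
by apply: le_trans h _; rewrite ler_wpM2r // lerDl.
Qed.
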